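(* There exists a polynomial-time algorithm that takes as input an interval graph $G$ and a linear coloring of $G$ of size $k$, and outputs a centered coloring of $G$ of size at most $k^2$.
   Context: A graph $G$ is an interval graph if there is an injective map $f$ from $V(G)$ to intervals of the real line such that $uv\in E(G)$ iff $f(u)$ and $f(v)$ overlap. A coloring of $G$ is a map $\psi: V(G)\to\{1,\dots,k\}$; its size is $k$. For a subgraph $H$, a vertex $v\in V(H)$ is a center of $H$ if $\psi(v)$ is the color of no other vertex of $H$. A centered coloring is a coloring in which every connected subgraph has a center. A linear coloring is a coloring in which every path (as a subgraph, not necessarily induced) has a center. *)

(* Defs.v *)
From HB Require Import structures.
From mathcomp Require Import all_boot all_order all_algebra.
From mathcomp Require Import boolp classical_sets reals num_normedtype.

Set Implicit Arguments.
Unset Strict Implicit.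
Unset Printing Implicit Defensive.

Record sgraph (V : finType) := SGraph {
  adj :> rel V;
  adj_sym : symmetric adj;
  adj_irr : irreflexive adj }.

(* Intervals are arbitrary convex subsets of the line (open, closed, half-open,
   bounded or not), so [f] is injective as a map to sets of reals; two
   intervals overlap when they have a common point. *)
Definition interval_graph (R : realType) (V : finType) (G : sgraph V) : Prop :=
  exists f : V -> set R,
    [/\ injective f,
        forall u, is_interval (f u) &
        forall u v, u != v -> (G u v <-> (f u `&` f v !=set0)%classic)].

(* Not necessarily induced: the edges are any symmetric subrelation of the
   adjacency relation of [G] between the chosen vertices. *)
Record subgraph (V : finType) (G : sgraph V) := Subgraph {
  sverts : {set V};
  sadj : rel V;
  sadj_sym : symmetric sadj;
  sadj_sub : forall x y, sadj x y -> [/\ x \in sverts, y \in sverts & G x y] }.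

Definition is_connected (V : finType) (G : sgraph V) (H : subgraph G) : Prop :=
  sverts H != finset.set0 /\ {in sverts H &, forall x y, connect (sadj H) x y}.

(* [infix [:: x; y] s] says that x and y occur consecutively in s. *)
Definition is_path (V : finType) (G : sgraph V) (H : subgraph G) : Prop :=
  exists s : seq V,
    [/\ s != [::], uniq s, sverts H =i s &
        forall x y, sadj H x y = infix [:: x; y] s || infix [:: y; x] s].

(* A coloring of size k is a map to 'I_k; c : 'I_k stands for the color c.+1. *)
Definition center (V : finType) (G : sgraph V) k (psi : V -> 'I_k)
    (H : subgraph G) (v : V) : Prop :=
  v \in sverts H /\ {in sverts H, forall w, psi w = psi v -> w = v}.

Definition centered_coloring (V : finType) (G : sgraph V) k (psi : V -> 'I_k) :
    Prop :=
  forall H : subgraph G, is_connected H -> exists v, center psi H v.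

Definition linear_coloring (V : finType) (G : sgraph V) k (psi : V -> 'I_k) :
    Prop :=
  forall H : subgraph G, is_path H -> exists v, center psi H v.

(* Algorithms are programs of a random access machine, in structured form: the
   state consists of registers and a memory, all holding natural numbers, every
   elementary instruction and every test costs one unit, and the arithmetic is
   limited to addition and truncated subtraction. With this instruction set the
   word length grows by at most one bit per step (beyond the constants of the
   program), so polynomial time, measured in the bit length of the input, is
   the same as on Turing machines. *)
Inductive prog :=
  | Const of nat & nat           (* r_i := c *)
  | Add of nat & nat & nat       (* r_i := r_j + r_l *)
  | Subtract of nat & nat & nat  (* r_i := r_j - r_l, truncated *)
  | Fetch of nat & nat           (* r_i := cell[r_j] *)
  | Store of nat & nat           (* cell[r_i] := r_j *)
  | Seq of prog & prog
  | If of nat & prog & prog      (* if r_i != 0 *)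
  | While of nat & prog.         (* while r_i != 0 *)

Record state := State { register : nat -> nat; cell : nat -> nat }.

Definition set_reg (s : state) (i a : nat) : state :=
  State [eta register s with i |-> a] (cell s).

Definition set_cell (s : state) (i a : nat) : state :=
  State (register s) [eta cell s with i |-> a].

(* [exec A s t s']: started in s, A halts in s' after exactly t steps. *)
Inductive exec : prog -> state -> nat -> state -> Prop :=
  | exec_const s i c : exec (Const i c) s 1 (set_reg s i c)
  | exec_add s i j l :
      exec (Add i j l) s 1 (set_reg s i (register s j + register s l))
  | exec_subtract s i j l :
      exec (Subtract i j l) s 1 (set_reg s i (register s j - register s l))
  | exec_fetch s i j :
      exec (Fetch i j) s 1 (set_reg s i (cell s (register s j)))
  | exec_store s i j :
      exec (Store i j) s 1 (set_cell s (register s i) (register s j))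
  | exec_seq A B s t s' t' s'' :
      exec A s t s' -> exec B s' t' s'' -> exec (Seq A B) s (t + t') s''
  | exec_if_true i A B s t s' :
      register s i != 0 -> exec A s t s' -> exec (If i A B) s t.+1 s'
  | exec_if_false i A B s t s' :
      register s i = 0 -> exec B s t s' -> exec (If i A B) s t.+1 s'
  | exec_while_true i A s t s' t' s'' :
      register s i != 0 -> exec A s t s' -> exec (While i A) s' t' s'' ->
      exec (While i A) s (t + t').+1 s''
  | exec_while_false i A s : register s i = 0 -> exec (While i A) s 1 s.

(* Input and output are words of numbers, stored in the memory from address 0
   on, with the length in register 0; everything else is initially 0. *)
Definition initial (input : seq nat) : state :=
  State [eta (fun=> 0) with 0 |-> size input] (nth 0 input).

Definition output (s : state) : seq nat := mkseq (cell s) (register s 0).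

Definition runs (A : prog) (input : seq nat) (t : nat) (out : seq nat) : Prop :=
  exists2 s, exec A (initial input) t s & output s = out.

(* Total length of the binary numerals; the numeral of 0 has length 1. *)
Definition bit_size (input : seq nat) : nat :=
  \sum_(w <- input) (trunc_log 2 w).+1.

Definition encode_coloring n k (psi : 'I_n -> 'I_k) : seq nat :=
  k :: [seq (psi v).+1 | v <- enum 'I_n].

(* Number of vertices followed by the adjacency matrix, row by row. *)
Definition encode_graph n (G : sgraph 'I_n) : seq nat :=
  n :: [seq nat_of_bool (G u v) | u <- enum 'I_n, v <- enum 'I_n].

Definition encode_input n (G : sgraph 'I_n) k (psi : 'I_n -> 'I_k) : seq nat :=
  encode_graph G ++ encode_coloring psi.

(* Main.v *)
(* In an interval graph whose vertices are sorted by right endpoint, the vertices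
   reachable from a given one along increasing adjacent steps form a path. A
   linear coloring thus has a center on each such path; deleting the centers one
   after the other, and counting along the way the colors that no longer occur,
   gives a centered coloring with at most k^2 colors. The algorithm does not look
   at the given coloring: it computes an optimal centered coloring. The
   separators needed are common neighborhoods of two vertices, so the components
   met are determined by two separators and a vertex, and dynamic programming
   over these polynomially many components gives the colors of a separator to
   no other vertex and shares those of the pieces on its two sides. *)

Require Import Defs.
From mathcomp Require Import all_boot all_order all_algebra.
From mathcomp Require Import reals.
From mathcomp Require Import boolp.
From mathcomp Require Import zify.

Set Implicit Arguments.
Unset Strict Implicit.
Unset Printing Implicit Defensive.

Import Order.TTheory.

(** * Orderings of interval graphs by right endpoints *)

(** The number of colors comes from two nested inductions. A linear coloring is proper, so a piece
    entirely adjacent to one vertex misses the color of that vertex; such a piece is left to the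
    outer induction, on the number of colors, at a price of c^2. Along a path, each deleted center
    takes its color away from what remains of the path, so at most c+1 deletions are nested, and
    (c+1) + c^2 <= (c+1)^2. The program has no interval representation at hand and computes none: it
    tries every pair of vertices as a separator. This is safe because the tables describe genuine
    centered colorings in any graph, for any pairs. The vertex ordering enters only in the proof of
    optimality, where the competitor is an arbitrary centered coloring. The private colors of a
    separator and the colors of the remaining vertices are disjoint there, which is what makes the
    recurrence exact. A region whose colors are all distinct may offer no separator; a pair of equal
    vertices, cutting everything, accounts for it. *)

Definition umbrella (V : finType) (G : sgraph V) (rk : V -> nat) : Prop :=
  injective rk /\
  forall a b c, rk a < rk b -> rk b < rk c -> G a c -> G b c.

(* Right endpoints are compared through downward closures, so that they need
   not be attained. *)
Lemma interval_umbrella (R : realType) (V : finType) (G : sgraph V) :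
  interval_graph R G -> exists rk, umbrella G rk.
Proof.
case=> f [_ f_itv f_adj].
pose le u v := `[< forall x, f u x -> exists2 y, f v y & (x <= y)%R >].
have le_tr : transitive le.
  move=> v u w /asboolP uv /asboolP vw; apply/asboolP => x /uv[y /vw[z fz yz] xy].
  by exists z => //; apply: le_trans xy yz.
have le_tot : total le.
  move=> u v; case: (boolP (le u v)) => //= /asboolP uv; apply/asboolP => y fy.
  have [x [fx nx]] : exists x, f u x /\ ~ exists2 y, f v y & (x <= y)%R.
    apply: contrapT => nex; apply: uv => x fx; apply: contrapT => nx.
    by apply: nex; exists x.
  exists x => //; rewrite leNgt; apply/negP => xy.
  by apply: nx; exists y => //; apply: ltW.
pose s := sort le (enum V).
have s_all x : x \in s by rewrite mem_sort mem_enum.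
exists (index^~ s); split=> [x y e | a b c ab bc Gac].
  by rewrite -(nth_index x (s_all x)) e nth_index.
have s_le u v : index u s < index v s -> le u v.
  by apply: (sorted_ltn_index le_tr) => //; apply: sort_sorted.
have ac : a != c by apply: contraTneq (ltn_trans ab bc) => ->; rewrite ltnn.
have bc' : b != c by apply: contraTneq bc => ->; rewrite ltnn.
have [x [fax fcx]] := (f_adj a c ac).1 Gac.
apply/(f_adj b c bc').
(* A point [x] common to [a] and [c] climbs to some [y] of [b], then to some [z] of [c]; convexity
   of the interval of [c] puts [y] in it. *)
have /asboolP /(_ x fax)[y fby xy] := s_le _ _ ab.
have /asboolP /(_ y fby)[z fcz yz] := s_le _ _ bc.
exists y; split=> //.
by apply: (f_itv c x z) => //; rewrite xy yz.
Qed.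

(** * Centered colorings of induced subgraphs *)

Section Induced.

Variables (V : finType) (G : sgraph V).
Implicit Types (D E X : {set V}) (v x y z : V).

Definition inrel (D : {set V}) : rel V :=
  fun x y => [&& x \in D, y \in D & G x y].

Definition conn (D : {set V}) : Prop :=
  {in D &, forall x y, connect (inrel D) x y}.

Definition component (D : {set V}) (x : V) : {set V} :=
  [set y in D | connect (inrel D) x y].

Definition centered_on (C : eqType) (phi : V -> C) (D : {set V}) : Prop :=
  forall X : {set V}, X \subset D -> X != set0 -> conn X ->
  exists2 v, v \in X & {in X, forall w, phi w = phi v -> w = v}.

Lemma inrel_sym D : symmetric (inrel D).
Proof. by move=> x y; rewrite /inrel (adj_sym G) andbCA. Qed.

Lemma connect_inrelC D : connect_sym (inrel D).
Proof. exact/sym_connect_sym/inrel_sym. Qed.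

Lemma connect_inrelS (D E : {set V}) : D \subset E ->
  subrel (connect (inrel D)) (connect (inrel E)).
Proof.
move=> DE; apply: connect_sub => x y /and3P[xD yD Gxy]; apply: connect1.
by rewrite /inrel !(subsetP DE).
Qed.

Lemma component_sub D x : component D x \subset D.
Proof. by apply/subsetP => y; rewrite inE => /andP[]. Qed.

Lemma mem_component D x : x \in D -> x \in component D x.
Proof. by move=> xD; rewrite inE xD connect0. Qed.

Lemma conn_ind (D : {set V}) (P : V -> Prop) x :
  conn D -> x \in D -> P x ->
  {in D &, forall y z, G y z -> P y -> P z} -> {in D, forall y, P y}.
Proof.
move=> Dc xD Px PG y yD; have /connectP[p] := Dc x y xD yD.
elim: p x xD Px {yD} => [|z p IHp] x xD Px /=; first by move=> _ ->.
by case/andP=> /and3P[_ zD Gxz]; apply: IHp => //; apply: PG Px.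
Qed.

Lemma component_closed D x y z :
  y \in component D x -> z \in D -> G y z -> z \in component D x.
Proof.
rewrite !inE => /andP[yD xy] zD Gyz; rewrite zD.
by apply: connect_trans xy (connect1 _); rewrite /inrel yD zD.
Qed.

Lemma connect_comp D x y :
  x \in D -> connect (inrel D) x y -> connect (inrel (component D x)) x y.
Proof.
move=> xD /connectP[p]; elim/last_ind: p y => [|p z IHp] y.
  by move=> _ ->; apply: connect0.
rewrite rcons_path last_rcons => /andP[xp lz] ->.
have ly := IHp _ xp erefl.
have lyC : last x p \in component D x.
  rewrite inE; case/and3P: lz => -> _ _ /=.
  by apply/connectP; exists p.
apply: connect_trans ly (connect1 _); rewrite /inrel lyC.
by case/and3P: lz => _ zD Gz; rewrite (component_closed lyC) // Gz.
Qed.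

Lemma component_conn D x : x \in D -> conn (component D x).
Proof.
move=> xD y z; rewrite !inE => /andP[yD xy] /andP[zD xz].
apply: connect_trans (connect_comp xD xz).
by rewrite connect_inrelC; apply: connect_comp.
Qed.

Lemma eq_component D x y : y \in component D x -> component D y = component D x.
Proof.
rewrite inE => /andP[yD xy]; apply/setP => z; rewrite !inE; congr (_ && _).
by apply/idP/idP; apply: connect_trans; rewrite // connect_inrelC.
Qed.

Lemma sub_component (D X : {set V}) x :
  X \subset D -> conn X -> x \in X -> X \subset component D x.
Proof.
move=> XD Xc xX; apply/subsetP => y yX; rewrite inE (subsetP XD) //.
exact: connect_inrelS XD _ _ (Xc _ _ xX yX).
Qed.

Lemma centered_onS (C : eqType) (phi : V -> C) (D E : {set V}) :
  D \subset E -> centered_on phi E -> centered_on phi D.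
Proof. by move=> DE cE X /subset_trans/(_ DE); apply: cE. Qed.

Lemma eq_in_centered (C : eqType) (phi psi : V -> C) (D : {set V}) :
  {in D, phi =1 psi} -> centered_on phi D -> centered_on psi D.
Proof.
move=> e c X XD X0 Xc; have [v vX vc] := c X XD X0 Xc.
exists v => // w wX; rewrite -!e ?(subsetP XD) //; exact: vc.
Qed.

Lemma centered_on_comps (C : eqType) (phi : V -> C) (D : {set V}) :
  {in D, forall x, centered_on phi (component D x)} -> centered_on phi D.
Proof.
move=> c X XD X0 Xc; have [x xX] := set0Pn _ X0.
by apply: (c x) => //; [apply: subsetP xX | apply: sub_component].
Qed.

Lemma centered_onT k (psi : V -> 'I_k) :
  centered_on psi [set: V] -> centered_coloring G psi.
Proof.
move=> c H [H0 Hc]; have [] := c (sverts H) => //.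
- move=> x y xH yH; apply: connect_sub (Hc x y xH yH) => u v uv.
  by case: (sadj_sub uv) => uH vH Guv; apply: connect1; rewrite /inrel uH vH.
- by move=> v vH vc; exists v.
Qed.

(** * Existence of centered colorings with few colors *)

Definition depth_le (m : nat) (D : {set V}) : Prop :=
  exists2 phi : V -> nat, {in D, forall v, phi v < m} & centered_on phi D.

Lemma depth_leW m p D : m <= p -> depth_le m D -> depth_le p D.
Proof. by move=> mp [phi lt c]; exists phi => // v /lt/leq_trans; apply. Qed.

Lemma depth_le_comps m D :
  {in D, forall x, depth_le m (component D x)} -> depth_le m D.
Proof.
move=> dC.
have /fin_all_exists[phi phiP] : forall x, exists phi : V -> nat, x \in D ->
    {in component D x, forall v, phi v < m} /\ centered_on phi (component D x).
  move=> x; case: (boolP (x \in D)) => [/dC[phi ? ?] | _]; last by exists (fun=> 0).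
  by exists phi.
(* A canonical representative makes all vertices of a component use the same [phi]; distinct
   components can reuse the same [m] colors because a connected set meets only one of them. *)
pose r x := fingraph.root (inrel D) x.
have rC x : x \in D -> r x \in D /\ component D (r x) = component D x.
  move=> xD; have xr := connect_root (inrel D) x.
  have rD : r x \in component D x.
    rewrite inE xr andbT; case/connectP: xr => p; rewrite -/(r x) => xp ->.
    by elim: p x xD xp => //= y p IHp x xD /andP[/and3P[_ yD _]]; apply: IHp.
  by split; [apply: subsetP (component_sub D x) _ rD | apply: eq_component].
exists (fun v => phi (r v) v).
  move=> v vD; have [rD eC] := rC v vD.
  by have [lt _] := phiP _ rD; apply: lt; rewrite eC mem_component.
apply: centered_on_comps => x xD; have [rD eC] := rC x xD.
have [_] := phiP _ rD; rewrite eC; apply: eq_in_centered => y.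
by rewrite inE => /andP[_ /(fingraph.rootP (connect_inrelC D)) e]; rewrite /r e.
Qed.

(** The new color [m] goes to [v] alone, which is then a center of every connected set containing
    it. *)
Lemma depth_le_del m D v : depth_le m (D :\ v) -> depth_le m.+1 D.
Proof.
case=> phi lt c; exists (fun x => if x == v then m else phi x).
  move=> x xD; case: eqVneq => // xv; rewrite ltnS ltnW // lt //.
  by rewrite !inE xv.
move=> X XD X0 Xc; case: (boolP (v \in X)) => [vX | vX].
  exists v => // w wX; rewrite eqxx; case: eqVneq => // wv e.
  by have := lt w; rewrite !inE wv (subsetP XD) // e ltnn => /(_ isT).
have XDv : X \subset D :\ v by rewrite subsetD1 XD.
have [u uX uc] := c X XDv X0 Xc; exists u => // w wX.
have nv z : z \in X -> (z == v) = false.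
  by move=> zX; apply: contraNF vX => /eqP <-.
by rewrite !nv //; apply: uc.
Qed.

End Induced.

Section FewColors.

Variables (V : finType) (G : sgraph V) (k : nat) (psi : V -> 'I_k).
Hypothesis psi_lin : linear_coloring G psi.
Implicit Types (D E : {set V}) (s x y z : V).

(** The subgraph keeps only the edges between consecutive vertices of [s], so chords do no harm;
    this is where paths that are not induced matter. *)
Lemma path_center (s : seq V) :
  s != [::] -> uniq s -> (forall x y, infix [:: x; y] s -> G x y) ->
  exists2 v, v \in s & {in s, forall w, psi w = psi v -> w = v}.
Proof.
move=> s0 s_uniq sG.
pose e x y := infix [:: x; y] s || infix [:: y; x] s.
have e_sym : symmetric e by move=> x y; rewrite /e orbC.
have e_sub x y : e x y -> [/\ x \in [set z in s], y \in [set z in s] & G x y].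
  have inf_in u v : infix [:: u; v] s -> (u \in s) && (v \in s).
    by case/infixP => p [q ->]; rewrite !mem_cat !inE !eqxx /= !orbT.
  by rewrite !inE; case/orP=> h; case/andP: (inf_in _ _ h) => -> ->;
    split=> //; [|rewrite (adj_sym G)]; apply: sG.
have [|v [vs vc]] := psi_lin (H := Subgraph e_sym e_sub).
  by exists s; split=> // x; rewrite inE.
exists v; first by rewrite inE in vs.
by move=> w ws; apply: vc; rewrite inE.
Qed.

Lemma linear_proper u v : G u v -> psi u != psi v.
Proof.
move=> Guv; have uv : u != v.
  by apply: contraTneq Guv => ->; rewrite (adj_irr G).
have s_adj x y : infix [:: x; y] [:: u; v] -> G x y.
  by case/infixP => -[|a [|b [|c p]]] [q] //= [<- <-].
have [] // := path_center (s := [:: u; v]) _ _ s_adj; first by rewrite /= inE uv.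
move=> w; rewrite !inE => /orP[] /eqP -> wc; apply: contra uv => /eqP e.
  by rewrite (wc v) ?eqxx // !inE eqxx orbT.
by rewrite -(wc u) ?eqxx // !inE eqxx.
Qed.

Variable rk : V -> nat.
Hypothesis rk_umb : umbrella G rk.

Let rk_inj : injective rk := rk_umb.1.
Let rk_adj : forall a b c, rk a < rk b -> rk b < rk c -> G a c -> G b c :=
  rk_umb.2.

Lemma rk_cases x y : x != y -> rk x < rk y \/ rk y < rk x.
Proof.
by move=> xy; apply/orP; rewrite -neq_ltn; apply: contra xy => /eqP/rk_inj ->.
Qed.

Definition increl (D : {set V}) : rel V :=
  fun x y => [&& y \in D, G x y & rk x < rk y].

(* The source [s] belongs to [reach D s] only if it belongs to [D]. *)
Definition reach (D : {set V}) (s : V) : {set V} :=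
  [set y in D | connect (increl D) s y].

Lemma in_reach D s y :
  (y \in reach D s) = (y \in D) && connect (increl D) s y.
Proof. by rewrite inE. Qed.

Lemma increl_rk D s y : connect (increl D) s y -> y = s \/ rk s < rk y.
Proof.
case/connectP=> p; elim/last_ind: p y => [|p z IHp] y; first by left.
rewrite rcons_path last_rcons => /andP[sp /and3P[_ _ lt]] ->; right.
by case: (IHp _ sp erefl) => [<- //|/ltn_trans]; apply.
Qed.

Lemma increl_pred D s y : connect (increl D) s y -> y != s ->
  exists e, [/\ connect (increl D) s e, G e y, rk e < rk y & y \in D].
Proof.
case/connectP=> p; case/lastP: p => [|p z].
  by move=> _ ->; rewrite eqxx.
rewrite rcons_path last_rcons => /andP[sp /and3P[zD Gz lt]] -> _.
by exists (last s p); split=> //; apply/connectP; exists p.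
Qed.

Lemma increl_mem D s y : connect (increl D) s y -> y = s \/ y \in D.
Proof.
move=> sy; case: (eqVneq y s) => [|ys]; first by left.
by right; have [e []] := increl_pred sy ys.
Qed.

Lemma increlS D E s y : D \subset E ->
  connect (increl D) s y -> connect (increl E) s y.
Proof.
move=> DE; apply: connect_sub => u v /and3P[vD Guv lt]; apply: connect1.
by rewrite /increl (subsetP DE) // Guv.
Qed.

(* Listed by increasing rank, [reach D s] is a path: each vertex has a
   neighbour of smaller rank, which the umbrella property transports to the
   vertex just before it. *)
Lemma reach_center D s : reach D s != set0 ->
  exists2 v, v \in reach D s &
    {in reach D s, forall w, psi w = psi v -> w = v}.
Proof.
move=> T0; set T := reach D s in T0 *.
pose le x y := rk x <= rk y.
have le_tr : transitive le by move=> y x z; apply: leq_trans.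
pose q := sort le (enum T).
have qT x : (x \in q) = (x \in T) by rewrite mem_sort mem_enum.
have q_sorted : sorted le q by apply: sort_sorted => x y; apply: leq_total.
have q_uniq : uniq q by rewrite sort_uniq enum_uniq.
have [] := @path_center q.
- by apply: contraNneq T0 => q0; apply/eqP/setP => x; rewrite -qT q0 inE.
- by [].
- move=> x y /infixP[p1 [p2 eq]].
  have xT : x \in T by rewrite -qT eq mem_cat !inE eqxx orbT.
  have yT : y \in T by rewrite -qT eq mem_cat !inE eqxx !orbT.
  have : pairwise le q by rewrite -sorted_pairwise.
  rewrite eq pairwise_cat /= => /and4P[/allrelP p1le _ /andP[xy _]].
  case/andP=> yp2 _.
  have lt : rk x < rk y.
    case: (@rk_cases x y) => //; last by rewrite ltnNge; move: xy; rewrite /le => ->.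
    apply: contraTneq q_uniq => exy.
    by rewrite eq cat_uniq /= exy inE eqxx /= !andbF.
  have [xD sx] : x \in D /\ connect (increl D) s x.
    by move: xT; rewrite inE => /andP[].
  have [yD sy] : y \in D /\ connect (increl D) s y.
    by move: yT; rewrite inE => /andP[].
  have ys : y != s.
    apply: contraTneq lt => ->; rewrite -leqNgt.
    by case: (increl_rk sx) => [-> //|/ltnW].
  have [e [se Gey ey _]] := increl_pred sy ys.
  have ex : rk e <= rk x.
    case: (increl_mem se) => [->|eD].
      by case: (increl_rk sx) => [-> //|/ltnW].
    have : e \in q by rewrite qT inE eD.
    rewrite eq mem_cat !inE => /or4P[ep|/eqP -> //|/eqP e_y|ep].
    + by apply: p1le => //; rewrite inE eqxx.
    + by move: ey; rewrite e_y ltnn.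
    + by have := allP yp2 _ ep; rewrite /le leqNgt ey.
  case: (eqVneq e x) => [<- //|/rk_cases[ex'|]]; last by rewrite ltnNge ex.
  exact: rk_adj ex' lt Gey.
- move=> v; rewrite qT => vT vc; exists v => // w wT; apply: vc.
  by rewrite qT.
Qed.

(** * Successive deletion of path centers *)

Section Layer.

Variables (D0 : {set V}) (N : nat).
Hypothesis dominated_depth : forall (D : {set V}) s, D \subset D0 -> s \in D0 ->
  {in D, forall y, G s y} -> depth_le G N D.

(** Exactly the condition for [reach D s] to be nonempty, expressed by the first step of the
    chain. *)
Definition entered (D : {set V}) (s : V) : bool :=
  (s \in D) || [exists z in D, G s z && (rk s < rk z)].

(* The vertex [s] is the last deleted vertex on the left of [D] (or the first
   vertex of [D] if nothing was deleted there): every vertex of [D] that ends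
   before [s] overlaps [s]. *)
Definition bounded_by (D : {set V}) (s : V) : Prop :=
  [/\ D \subset D0, s \in D0, conn G D, entered D s
    & {in D, forall y, rk y < rk s -> G s y}].

Section Deletion.

Variables (D : {set V}) (s v x : V).
Hypotheses (Ds : bounded_by D s) (vT : v \in reach D s) (xD : x \in D :\ v).
Let D' := component G (D :\ v) x.
Hypothesis nD' : ~~ entered D' s.

Let D'D y : y \in D' -> y \in D :\ v.
Proof. exact: subsetP (component_sub _ _ _) y. Qed.

Let sD' : s \notin D'.
Proof. by move: nD'; rewrite /entered negb_or => /andP[]. Qed.

Let no_entry y : y \in D' -> G s y -> rk s < rk y -> False.
Proof.
move=> yD' Gsy lt; case/negP: nD'; apply/orP; right.
by apply/existsP; exists y; rewrite yD' Gsy.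
Qed.

Let xD' : x \in D' := mem_component G xD.
Let D'c : conn G D' := component_conn (G := G) xD.

(** Otherwise [D'] would be closed under adjacency in the connected set [D], and would contain
    [v]. *)
Lemma neighbour_in_comp : exists2 y, y \in D' & G v y.
Proof.
apply: contrapT => none; have [_ _ Dc _ _] := Ds.
have [vD xDv] : v \in D /\ x \in D.
  by move: vT xD; rewrite !inE => /andP[-> _] /andP[_ ->].
suff : v \in D' by move/D'D; rewrite !inE eqxx.
apply: (conn_ind (P := fun y => y \in D') Dc xDv xD') vD => y z _ zD Gyz /= yD'.
apply: (component_closed yD' _ Gyz); rewrite !inE zD andbT.
by apply: contra_notN none => /eqP e; exists y => //; rewrite -e (adj_sym G).
Qed.

(** An edge of [D'] passing over [s] would make its upper end adjacent to [s], that is, an entry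
    from [s] into [D']. *)
Lemma comp_side y z : y \in D' -> z \in D' -> rk y < rk s -> rk z < rk s.
Proof.
move=> yD' zD' ys.
apply: (conn_ind (P := fun y => rk y < rk s) D'c yD' ys) zD' => a b aD bD Gab as_.
have : b != s by apply: contraNneq sD' => <-.
case/rk_cases => // sb; case: (no_entry bD) => //.
exact: rk_adj as_ sb Gab.
Qed.

(** The chain stays outside [D']: a member in [D'] would pull its predecessor into [D'], unless that
    predecessor is [s], which has no entry. Nor can it jump over [y], since the upper end of such a
    step would be adjacent to [y] and so belong to [D']. *)
Lemma chain_below c y : connect (increl (D :\ v)) s c ->
  y \in D' -> rk s < rk y -> rk c < rk y.
Proof.
move=> sc yD' sy; suff [] : c \notin D' /\ rk c < rk y by [].
case/connectP: sc => p; elim/last_ind: p c => [|p z IHp] c; first by move=> _ ->.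
rewrite rcons_path last_rcons => /andP[sp /and3P[zD Gz lt]] ->.
have [lD' ly] := IHp _ sp erefl.
have zD' : z \notin D'.
  apply: contraNN lD' => zD'.
  have : connect (increl (D :\ v)) s (last s p) by apply/connectP; exists p.
  case/increl_mem => [e|lD]; last first.
    by apply: component_closed zD' lD _; rewrite (adj_sym G).
  by rewrite e in lt Gz; case: (no_entry zD' Gz lt).
split=> //; have : z != y by apply: contraNneq zD' => ->.
case/rk_cases => // yz; case/negP: zD'.
by apply: component_closed yD' zD _; apply: rk_adj ly yz Gz.
Qed.

(** Ranks increase along the chain, so the part that precedes [v] survives the deletion of [v]. *)
Lemma pred_deleted : v != s ->
  exists e, [/\ connect (increl (D :\ v)) s e, G e v & rk e < rk v].
Proof.
have sv : connect (increl D) s v by move: vT; rewrite inE => /andP[].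
move=> vs; have [e [se Gev ev _]] := increl_pred sv vs.
exists e; split=> //; case/connectP: se => p; elim/last_ind: p e ev {Gev}.
  by move=> e _ _ ->; apply: connect0.
move=> p z IHp e ev; rewrite rcons_path last_rcons.
move=> /andP[sp /and3P[zD Gz lt]] ez; subst z.
apply: connect_trans (IHp _ (ltn_trans lt ev) sp erefl) (connect1 _).
by rewrite /increl !inE zD Gz lt !andbT; apply: contraTneq ev => ->; rewrite ltnn.
Qed.

(** The predecessor of [v] on the chain has smaller rank than all of [D'], by [chain_below]; its
    adjacency to [v] passes to every vertex ranked between the two. The case [v = s] is excluded
    because a neighbour of [v] in [D'] would be an entry from [s]. *)
Lemma right_comp : ~~ (rk x < rk s) ->
  v != s /\ {in D', forall y, rk s < rk y /\ (rk y < rk v -> G v y)}.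
Proof.
move=> xs; have D's y : y \in D' -> rk s < rk y.
  move=> yD'; have : y != s by apply: contraNneq sD' => <-.
  by case/rk_cases => // ys; case/negP: xs; apply: comp_side yD' xD' ys.
have vs : v != s.
  apply/eqP => e; have [y yD' Gvy] := neighbour_in_comp.
  by case: (no_entry yD'); rewrite ?D's // -e.
split=> // y yD'; split=> [|yv]; first exact: D's.
have [e [se Gev ev]] := pred_deleted vs.
by rewrite (adj_sym G); apply: rk_adj (chain_below se yD' (D's _ yD')) yv Gev.
Qed.

(* Either [v] becomes the left boundary of the component, or some deleted
   vertex is adjacent to the whole component. *)
Lemma comp_boundary : bounded_by D' v \/ depth_le G N D'.
Proof.
have [DD0 sD0 _ _ Dlt] := Ds.
have vD : v \in D by move: vT; rewrite inE => /andP[].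
have D'D0 : D' \subset D0.
  by apply: subset_trans DD0; apply/subsetP => y /D'D; rewrite inE => /andP[].
case: (boolP (rk x < rk s)) => [xs | /right_comp[vs D'P]].
  (* All of [D'] lies before [s], hence is adjacent to [s] by the boundary condition on [D]. *)
  right; apply: dominated_depth D'D0 sD0 _ => y yD'.
  have yD : y \in D by move: (D'D yD'); rewrite inE => /andP[].
  exact: Dlt yD (comp_side xD' yD' xs).
have vD' : v \notin D' by apply/negP => /D'D; rewrite !inE eqxx.
case: (boolP (entered D' v)) => ent; [left|right].
  split=> //; first exact: subsetP DD0 v vD.
  by move=> y /D'P[].
apply: dominated_depth D'D0 (subsetP DD0 v vD) _.
have [y0 y0D' Gvy0] := neighbour_in_comp.
have no_right y : y \in D' -> G v y -> rk y < rk v.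
  move=> yD' Gvy; have : y != v by apply: contraNneq vD' => <-.
  case/rk_cases => // vy; case/negP: ent; apply/orP; right.
  by apply/existsP; exists y; rewrite yD' Gvy.
(* Without an entry from [v], the connected set [D'] cannot pass over [v]; it lies before [v], and
   is therefore dominated by [v]. *)
have D'v : {in D', forall y, rk y < rk v}.
  apply: (conn_ind (P := fun y => rk y < rk v) D'c y0D' (no_right _ y0D' Gvy0)).
  move=> a b _ bD' Gab av; have : b != v by apply: contraNneq vD' => <-.
  case/rk_cases => // vb; apply: no_right => //; exact: rk_adj av vb Gab.
by move=> y yD'; apply: (D'P y yD').2; apply: D'v.
Qed.

End Deletion.

(** Induction on the number of colors of the path. The deleted center is alone on it with its color,
    and the path of a remaining component, issued from [s] or from [v], is part of the old path
    without [v]. The summand [N] pays for the components dominated by a vertex. *)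
Lemma bounded_depth m D s : bounded_by D s -> #|psi @: reach D s| <= m ->
  depth_le G (m + N) D.
Proof.
elim: m D s => [|m IHm] D s Ds.
  rewrite leqn0 cards_eq0 imset_eq0 => /eqP T0; have [_ _ _ ent _] := Ds.
  case/orP: ent => [sD | /existsP[z /and3P[zD Gsz lt]]].
    by have : s \in reach D s; [rewrite inE sD connect0 | rewrite T0 inE].
  have : z \in reach D s; last by rewrite T0 inE.
  by rewrite inE zD connect1 // /increl zD Gsz.
move=> cT.
have T0 : reach D s != set0.
  case: Ds => _ _ _ /orP[sD | /existsP[z /and3P[zD Gsz lt]]] _.
    by apply/set0Pn; exists s; rewrite inE sD connect0.
  by apply/set0Pn; exists z; rewrite inE zD connect1 // /increl zD Gsz.
have [v vT vc] := reach_center T0.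
have sv : connect (increl D) s v by move: vT; rewrite inE => /andP[].
have small E : v \notin E -> E \subset reach D s -> #|psi @: E| <= m.
  move=> vE ET; rewrite -ltnS; apply: leq_trans cT.
  rewrite (cardsD1 (psi v) (psi @: reach D s)) imset_f // ltnS.
  apply/subset_leq_card/subsetP => _ /imsetP[w wE ->].
  rewrite !inE imset_f ?(subsetP ET) // andbT.
  by apply: contraNneq vE => /vc <- //; apply: subsetP wE.
apply: (depth_le_del (v := v)); apply: depth_le_comps => x xD.
set D' := component G (D :\ v) x.
have D'D : D' \subset D by rewrite (subset_trans (component_sub _ _ _)) ?subsetDl.
have vD' : v \notin D'.
  by apply/negP => /(subsetP (component_sub _ _ _)); rewrite !inE eqxx.
have nreach t : v \notin reach D' t by rewrite inE (negbTE vD').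
case: (boolP (entered D' s)) => ent.
  apply: (IHm D' s).
    have [DD0 sD0 _ _ Dlt] := Ds; split=> //.
    - exact: subset_trans DD0.
    - exact: component_conn.
    - by move=> y /(subsetP D'D); apply: Dlt.
  apply: small => //; apply/subsetP => y; rewrite !in_reach => /andP[yD' sy].
  by rewrite (subsetP D'D) //=; apply: increlS D'D sy.
have [D'v | ] := comp_boundary Ds vT xD ent; last exact/depth_leW/leq_addl.
apply: (IHm D' v) => //; apply: small => //; apply/subsetP => y.
rewrite !in_reach => /andP[yD' vy]; rewrite (subsetP D'D) //=.
exact: connect_trans sv (increlS D'D vy).
Qed.

End Layer.

Lemma colors_depth c (D : {set V}) : #|psi @: D| <= c -> depth_le G (c ^ 2) D.
Proof.
elim: c D => [|c IHc] D.
  rewrite leqn0 cards_eq0 imset_eq0 => /eqP ->.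
  exists (fun=> 0) => [v|X]; first by rewrite inE.
  by rewrite subset0 => /eqP -> /eqP.
move=> Dc; apply: depth_le_comps => x xD.
(* From the vertex of least rank, the boundary condition on vertices before [s] is vacuous. *)
have [s sC smin] := arg_minnP (P := [pred y in component G D x]) rk
  (mem_component G xD).
rewrite inE in sC.
have dom (E : {set V}) t : E \subset D -> t \in D ->
    {in E, forall y, G t y} -> depth_le G (c ^ 2) E.
  move=> ED tD tE; apply: IHc; rewrite -ltnS; apply: leq_trans Dc.
  rewrite (cardsD1 (psi t) (psi @: D)) imset_f // ltnS.
  apply/subset_leq_card/subsetP => _ /imsetP[w wE ->].
  rewrite !inE imset_f ?(subsetP ED) // andbT eq_sym.
  by apply: linear_proper; apply: tE.
have sub := subsetP (component_sub G D x).
apply: (depth_leW (m := c.+1 + c ^ 2)); first by nia.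
apply: (bounded_depth dom (s := s)).
  split; [exact: component_sub | exact: sub | exact: component_conn | by rewrite /entered sC |].
  by move=> y yC; rewrite ltnNge smin.
apply: leq_trans Dc; apply/subset_leq_card/imsetS/subsetP => y.
by rewrite inE => /andP[/sub].
Qed.

End FewColors.

(** * Dynamic programming over separators *)

Section Separators.

Variables (V : finType) (G : sgraph V).
Implicit Types (c d y z : V) (A B S : V * V).

Definition common (S : V * V) : {set V} := [set z | G S.1 z && G S.2 z].

(* A pair of equal vertices stands for no separator at all when it bounds a
   region, and for the whole vertex set when it cuts one. *)
Definition barrier (S : V * V) : {set V} :=
  if S.1 == S.2 then set0 else common S.

Definition cut (S : V * V) : {set V} :=
  if S.1 == S.2 then setT else common S.

Definition area A B : {set V} := ~: (barrier A :|: barrier B).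

Definition region A B y : {set V} := component G (area A B) y.

Definition table := V * V -> V * V -> V -> nat.

(* [F A B z] bounds the number of colors used by [C A B] on the component of
   [z] in the area bounded by [A] and [B]. *)
Definition valid (F C : table) : Prop := forall A B,
  [/\ centered_on G (C A B) (area A B),
      {in area A B, forall z, C A B z < F A B z} &
      {in area A B &, forall y z, G y z -> F A B y = F A B z}].

(** The side of the cut on which [z] lies is not known to the program. Off the cut both tables give
    valid colorings, so the smaller bound may be taken, and it is at most that of the true side. *)
Definition rest (F : table) A B y S : nat :=
  \max_(z in region A B y :\: cut S) minn (F A S z) (F S B z).

Definition candidate (F : table) A B y S : nat :=
  #|region A B y :&: cut S| + rest F A B y S.

Lemma valid_const F C A B y z : valid F C -> y \in area A B ->
  z \in region A B y -> F A B z = F A B y.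
Proof.
move=> /(_ A B)[_ _ Fc] yA zR; have Rsub := subsetP (component_sub G (area A B) y).
apply: (conn_ind (P := fun z => F A B z = F A B y) (component_conn yA) (mem_component G yA))
  zR => // u v uR vR Guv <-.
by apply/esym/Fc; rewrite // Rsub.
Qed.

(** A connected set of the region that avoids the cut lies in both [area A S] and [area S B]. Both
    bounds are constant on it, so the comparison selects the same old coloring for all its vertices.
    Cut vertices receive distinct colors from [rest F A B y S] on, above every color used off the
    cut. The argument holds for any pair [S], separating or not. *)
Lemma valid_update F C F' C' A B y S (idx : V -> nat) :
    valid F C -> y \in area A B ->
    {in region A B y :&: cut S &, injective idx} ->
    {in region A B y :&: cut S, forall z, idx z < #|region A B y :&: cut S|} ->
    (forall A' B' z, F' A' B' z =
       if [&& A' == A, B' == B & z \in region A B y] then candidate F A B y S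
       else F A' B' z) ->
    (forall A' B' z, C' A' B' z =
       if [&& A' == A, B' == B & z \in region A B y] then
         if z \in cut S then rest F A B y S + idx z
         else if F A S z <= F S B z then C A S z else C S B z
       else C A' B' z) ->
  valid F' C'.
Proof.
move=> FC yA idx_inj idx_lt eF eC A' B'; have [FCc FClt FCe] := FC A' B'.
set D := region A B y in idx_inj idx_lt eF eC.
have Dsub : {subset D <= area A B} := subsetP (component_sub G (area A B) y).
case: (boolP ((A' == A) && (B' == B))) => [/andP[/eqP eA /eqP eB] | neAB]; last first.
  have e T (f : T) g z : (if [&& A' == A, B' == B & z \in D] then f else g) = g.
    by rewrite andbA (negbTE neAB).
  split.
  - by apply: eq_in_centered FCc => z _; rewrite eC e.
  - by move=> z /FClt; rewrite eC eF !e.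
  - by move=> u v uA vA /FCe; rewrite !eF !e; apply.
subst A' B'.
have eFD z : z \in D -> F' A B z = candidate F A B y S.
  by move=> zD; rewrite eF !eqxx zD.
have eFN z : z \notin D -> F' A B z = F A B z.
  by move=> zD; rewrite eF !eqxx (negbTE zD).
have inA1 z : z \in D -> z \notin cut S -> z \in area A S.
  move=> /Dsub; rewrite !inE !negb_or => /andP[-> _] /=.
  by rewrite /cut /barrier; case: ifP => // _; rewrite inE.
have inA2 z : z \in D -> z \notin cut S -> z \in area S B.
  move=> /Dsub; rewrite !inE !negb_or => /andP[_ ->]; rewrite andbT.
  by rewrite /cut /barrier; case: ifP => // _; rewrite inE.
have low z : z \in D -> z \notin cut S -> C' A B z < rest F A B y S.
  move=> zD zS; rewrite eC !eqxx zD /= (negbTE zS).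
  have : minn (F A S z) (F S B z) <= rest F A B y S.
    by apply: (leq_bigmax_cond (F := fun z => minn (F A S z) (F S B z)));
      rewrite inE zS.
  apply: leq_trans.
  have [_ /(_ z (inA1 z zD zS)) lt1 _] := FC A S.
  have [_ /(_ z (inA2 z zD zS)) lt2 _] := FC S B.
  by case: (leqP (F A S z) (F S B z)).
split.
- have step u v : u \in area A B -> v \in area A B -> G u v -> u \in D -> v \in D.
    by move=> _ vA Guv uD; apply: component_closed uD vA Guv.
  move=> X XA X0 Xc; case: (boolP [exists x in X, x \in D]) => [|none]; last first.
    have XD x : x \in X -> x \notin D.
      by move=> xX; apply: contra none => xD; apply/existsP; exists x; rewrite xX.
    have [v vX vc] := FCc X XA X0 Xc; exists v => // w wX.
    by rewrite !eC !eqxx /= !(negbTE (XD _ _)) //; apply: vc.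
  case/existsP=> x /andP[xX xD].
  have XD z : z \in X -> z \in D.
    move=> zX; apply: (conn_ind (P := fun z => z \in D) Xc xX xD) zX => u v uX vX.
    by apply: step; apply: subsetP XA _ _.
  case: (boolP [exists v in X, v \in cut S]) => [/existsP[v /andP[vX vS]] | none].
    exists v => // w wX; rewrite [C' A B v]eC !eqxx XD //= vS.
    case: (boolP (w \in cut S)) => wS; last first.
      by move=> e; have := low w (XD w wX) wS; rewrite e ltnNge leq_addr.
    rewrite eC !eqxx XD //= wS => /addnI; apply: idx_inj.
      by rewrite inE XD.
    by rewrite inE XD.
  have XS z : z \in X -> z \notin cut S.
    by move=> zX; apply: contra none => zS; apply/existsP; exists z; rewrite zX.
  have XA1 : X \subset area A S.
    by apply/subsetP => z zX; apply: inA1 (XD z zX) (XS z zX).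
  have XA2 : X \subset area S B.
    by apply/subsetP => z zX; apply: inA2 (XD z zX) (XS z zX).
  have F1 z : z \in X -> F A S z = F A S x.
    move=> zX; apply: valid_const FC (subsetP XA1 x xX) _.
    exact: subsetP (sub_component XA1 Xc xX) z zX.
  have F2 z : z \in X -> F S B z = F S B x.
    move=> zX; apply: valid_const FC (subsetP XA2 x xX) _.
    exact: subsetP (sub_component XA2 Xc xX) z zX.
  have eCX z : z \in X -> C' A B z = if F A S x <= F S B x then C A S z else C S B z.
    by move=> zX; rewrite eC !eqxx XD //= (negbTE (XS z zX)) F1 ?F2.
  have : exists2 v, v \in X & {in X, forall w,
      (if F A S x <= F S B x then C A S w else C S B w) =
      (if F A S x <= F S B x then C A S v else C S B v) -> w = v}.
    case: (F A S x <= F S B x); first by have [c _ _] := FC A S; apply: c.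
    by have [c _ _] := FC S B; apply: c.
  by case=> v vX vc; exists v => // w wX; rewrite !eCX //; apply: vc.
- move=> z zA; case: (boolP (z \in D)) => zD; last first.
    by rewrite eFN // eC !eqxx (negbTE zD) /=; apply: FClt.
  rewrite eFD // /candidate; case: (boolP (z \in cut S)) => zS; last first.
    exact: leq_trans (low z zD zS) (leq_addl _ _).
  by rewrite eC !eqxx zD /= zS addnC ltn_add2r idx_lt // inE zD.
- move=> u v uA vA Guv; case: (boolP (u \in D)) => uD.
    by rewrite !eFD //; apply: component_closed uD vA Guv.
  rewrite !eFN //; first exact: FCe.
  by apply: contra uD => vD; apply: component_closed vD uA _; rewrite (adj_sym G).
Qed.

(** Bounds only decrease during a pass, so a candidate computed from a partly updated table is no
    worse than the one from the table at the start of the pass. *)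
Lemma candidate_le F F' A B y S :
  (forall A B z, F A B z <= F' A B z) -> candidate F A B y S <= candidate F' A B y S.
Proof.
move=> FF'; rewrite leq_add2l; apply/bigmax_leqP => z zR.
apply: leq_trans (leq_bigmax_cond (F := fun z => minn (F' A S z) (F' S B z)) _ zR).
by rewrite leq_min !geq_min !FF' orbT.
Qed.

(** * Separators in an ordered interval graph *)

Variable rk : V -> nat.
Hypothesis rk_umb : umbrella G rk.

Let rk_inj : injective rk := rk_umb.1.

Definition left_end (y : V) : nat :=
  rk [arg min_(z < y | (z == y) || G z y) rk z].

Lemma left_end_ex y :
  exists2 w, left_end y = rk w & (w == y) || G w y.
Proof. by rewrite /left_end; case: arg_minnP => [|w wy _]; [rewrite eqxx | exists w]. Qed.

Lemma left_end_le y : left_end y <= rk y.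
Proof. by rewrite /left_end; case: arg_minnP => [|w _ ->]; rewrite ?eqxx. Qed.

(** The umbrella property extends the adjacency of [y] to its lowest neighbour to every vertex
    ranked between the two. *)
Lemma left_endP y z : rk z < rk y -> G z y = (left_end y <= rk z).
Proof.
move=> zy; apply/idP/idP => [Gzy|].
  by rewrite /left_end; case: arg_minnP => [|w _ ->]; rewrite ?eqxx ?Gzy ?orbT.
have [w -> /orP[/eqP ->|Gwy]] := left_end_ex y; first by rewrite leqNgt zy.
by rewrite leq_eqVlt => /orP[/eqP/rk_inj <- //|wz]; apply: rk_umb.2 wz zy Gwy.
Qed.

(* Vertices are intervals from [left_end] to [rk]; the position [p] separates
   those that lie below [p] from those that start at [p] or later. *)
Definition crossing p : {set V} := [set y | (p <= rk y) && (left_end y < p)].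

Lemma split_crossing p y : y \notin crossing p -> rk y < p \/ p <= left_end y.
Proof. by rewrite inE negb_and -!ltnNge ltnS => /orP. Qed.

Lemma right_closed p y z : z \notin crossing p -> G y z ->
  p <= left_end y -> p <= left_end z.
Proof.
move=> /split_crossing[zp|//] Gyz py; have zy : rk z < rk y.
  by apply: leq_trans (leq_trans zp py) (left_end_le y).
by move: Gyz; rewrite (adj_sym G) left_endP // leqNgt (leq_trans zp py).
Qed.

Lemma left_closed p y z : z \notin crossing p -> G y z ->
  rk y < p -> rk z < p.
Proof.
move=> /split_crossing[//|pz] Gyz yp; have yz : rk y < rk z.
  by apply: leq_trans (leq_trans yp pz) (left_end_le z).
by move: Gyz; rewrite left_endP // leqNgt (leq_trans yp pz).
Qed.

Lemma crossing_adj p d y : left_end d = p -> y \in crossing p -> G d y.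
Proof.
rewrite inE => dp /andP[py yp]; have : y != d by apply: contraTneq yp => ->; rewrite dp ltnn.
have dr := left_end_le d; rewrite dp in dr.
case/(rk_cases rk_umb) => h; first by rewrite (adj_sym G) left_endP // dp.
by rewrite left_endP // ltnW // (leq_trans yp).
Qed.

(** Adjacency to [d] forces a rank of at least [p], adjacency to [c] a left end below [p].
    Conversely, a left end is itself the rank of a vertex, so when it is below [p] it is at most
    [rk c] by maximality. *)
Lemma common_crossing c d p : left_end d = p -> rk c < p ->
  (forall y, rk y < p -> rk y <= rk c) -> common (c, d) = crossing p.
Proof.
move=> dp cp cmax; have pd : p <= rk d by rewrite -dp left_end_le.
apply/setP => y; rewrite in_set /=; apply/andP/idP => [[Gcy Gdy] | yK].
  rewrite inE; have py : p <= rk y.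
    rewrite leqNgt; apply/negP => yp; move: Gdy.
    by rewrite (adj_sym G) left_endP ?(leq_trans yp) // dp leqNgt yp.
  have cy := leq_trans cp py; rewrite py; move: Gcy; rewrite left_endP // => yc.
  exact: leq_ltn_trans yc cp.
split; last exact: crossing_adj yK.
move: yK; rewrite inE => /andP[py yp]; have cy := leq_trans cp py.
by rewrite left_endP //; have [w e _] := left_end_ex y; rewrite e cmax // -e.
Qed.

(* With a vertex [c] just before [p] and [d] starting at [p], the crossing
   vertices are exactly the common neighbours of [c] and [d]. *)
Definition is_crossing S p := barrier S = crossing p.

Definition between p q : {set V} := [set y | (p <= left_end y) && (rk y < q)].

Lemma between_area A B p q : is_crossing A p -> is_crossing B q ->
  between p q \subset area A B.
Proof.
move=> eA eB; apply/subsetP => y; rewrite !inE eA eB !inE => /andP[py yq].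
by rewrite !ltnNge py (leqNgt q) yq andbF.
Qed.

Lemma region_between A B p q y : is_crossing A p -> is_crossing B q ->
  y \in between p q -> region A B y \subset between p q.
Proof.
move=> eA eB yb; have yA := subsetP (between_area eA eB) y yb.
apply/subsetP; apply: (conn_ind (P := fun z => z \in between p q)
  (component_conn yA) (mem_component G yA) yb) => u v _ vR Guv.
have := subsetP (component_sub G _ _) v vR.
rewrite [v \in area _ _]inE [v \in _ :|: _]inE negb_or eA eB => /andP[vp vq].
rewrite !inE => /andP[pu uq].
by rewrite (right_closed vp Guv pu) (left_closed vq Guv uq).
Qed.

(* Uniquely colored vertices of [D] disconnect it, since a connected set has a
   center; hence they contain all vertices crossing some position. *)
Lemma separating_position (C : eqType) (phi : V -> C) (D U : {set V}) :
    centered_on G phi D ->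
    U = [set v in D | [forall w in D, (phi w == phi v) ==> (w == v)]] ->
    ~~ (D \subset U) ->
  exists c d, [/\ c != d, d \in D, common (c, d) = crossing (left_end d),
    crossing (left_end d) :&: D \subset U &
    exists2 e, e \in D & rk e < left_end d].
Proof.
move=> Dc eU; set W := D :\: U => DU.
have [e0 e0W] : exists e, e \in W.
  by case/subsetPn: DU => e eD eU'; exists e; rewrite inE eU'.
have [e /= eW emin] := arg_minnP (P := mem W) rk e0W.
set E := component G W e.
(* [W] is not connected: a center of [W] differs in color from the rest of [W], and also from [U],
   whose colors are unique in [D]; so it would itself belong to [U]. *)
have [d0 d0W] : exists d, (d \in W) && (d \notin E).
  apply: contrapT => none.
  have WE : W = E.
    apply/eqP; rewrite eqEsubset component_sub andbT; apply/subsetP => d dW.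
    by apply: contrapT => /negP dE; apply: none; exists d; rewrite dW.
  have [] := Dc W.
  - exact: subsetDl.
  - by apply/set0Pn; exists e.
  - by rewrite WE; apply: component_conn.
  move=> v vW vc; move: (vW); rewrite inE => /andP[/negP vU vD]; apply: vU.
  rewrite eU inE vD /=; apply/forall_inP => w wD; apply/implyP => /eqP wv.
  case: (boolP (w \in U)) => wU; last by rewrite (vc w) // inE wU.
  move: wU; rewrite eU inE => /andP[_ /forall_inP/(_ v vD)].
  by rewrite wv eqxx eq_sym.
(* The least left end outside [E] keeps [W] off [crossing p]: a vertex of [W] crossing [p] is
   adjacent to [d], hence also outside [E], and starts before [d]. *)
have [d /andP[dW dE] dmin] :=
  arg_minnP (P := [pred d | (d \in W) && (d \notin E)]) left_end d0W.
set p := left_end d in dmin *.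
have dD : d \in D by move: dW; rewrite inE => /andP[].
have KU : crossing p :&: W = set0.
  apply/setP => y; rewrite [RHS]inE; apply/negP => /setIP[yK yW].
  have Gdy : G d y by apply: crossing_adj yK.
  have yE : y \notin E.
    apply: contra dE => yE; apply: component_closed yE dW _.
    by rewrite (adj_sym G).
  have := dmin y; rewrite inE /= => h.
  move: yK; rewrite inE => /andP[_]; rewrite ltnNge h //.
  by rewrite yE andbT; move: yW; rewrite inE.
have ed : e != d by apply: contraNneq dE => <-; apply: mem_component.
have rk_ed : rk e < rk d.
  by case: (rk_cases rk_umb ed) => // de; have := emin d dW; rewrite leqNgt de.
have ep : rk e < p.
  have eK : e \notin crossing p.
    by apply: contra_eqN KU => eK; apply/set0Pn; exists e; rewrite inE eK.
  case: (split_crossing eK) => // pe; case/negP: dE.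
  apply: component_closed (mem_component G eW) dW _.
  by rewrite left_endP // (leq_trans pe) // left_end_le.
(* The last vertex before [p], which exists because [e] is before [p]. *)
have [c cp cmax] := arg_maxnP (P := [pred c | rk c < p]) rk ep.
exists c, d; split=> //.
- by apply: contraTneq cp => ->; rewrite /= -leqNgt left_end_le.
- by apply: common_crossing.
- apply/subsetP => y /setIP[yK yD]; have [//|yU] := boolP (y \in U).
  have : y \in crossing p :&: W by apply/setIP; split=> //; apply/setDP.
  by rewrite KU inE.
- by exists e => //; move: eW; rewrite inE => /andP[].
Qed.

(** The colors counted are those actually occurring on the region, so that they can be divided
    between a separator and the remaining vertices. *)
Definition optimal_upto (t : nat) (F : table) : Prop :=
  forall (C : finType) (phi : V -> C) A B p q y,
    is_crossing A p -> is_crossing B q -> y \in between p q ->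
    #|region A B y| <= t -> centered_on G phi (region A B y) ->
  F A B y <= #|phi @: region A B y|.

(** If the colors of the region are all distinct, the pair [(y, y)] cuts everything and costs one
    color per vertex. Otherwise the vertices of a separator have private colors, and the pieces on
    its sides, smaller than the region, are bounded by the number of remaining colors. *)
Lemma optimal_step t F F' : optimal_upto t F ->
    (forall A B y S, y \in area A B -> F' A B y <= candidate F A B y S) ->
  optimal_upto t.+1 F'.
Proof.
move=> Ft FF' C phi A B p q y eA eB yb.
have yA := subsetP (between_area eA eB) y yb.
set D := region A B y => Dt Dc.
set U := [set v in D | [forall w in D, (phi w == phi v) ==> (w == v)]].
have phiU v w : v \in U -> w \in D -> phi w = phi v -> w = v.
  rewrite inE => /andP[_ /forall_inP h] wD e; apply/eqP.
  by move: (h w wD); rewrite e eqxx.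
have DD : {subset D <= between p q} := subsetP (region_between eA eB yb).
case: (boolP (D \subset U)) => DU.
  rewrite card_in_imset => [|v w vD wD e]; last first.
    by apply: phiU e => //; apply: (subsetP DU).
  have -> : #|D| = candidate F A B y (y, y); last exact: FF'.
  rewrite /candidate /rest /cut eqxx setIT setDT big1 ?addn0 // => z.
  by rewrite inE.
have [c [d [cd dD eS KU [e eD ep]]]] := separating_position Dc (erefl U) DU.
set r := left_end d in eS KU ep; pose S := (c, d).
have eS' : cut S = crossing r by rewrite /cut (negbTE cd).
have eSb : is_crossing S r by rewrite /is_crossing /barrier (negbTE cd).
apply: leq_trans (FF' A B y S yA) _; rewrite /candidate eS' -/D.
have [pr rq] : p <= r /\ r < q.
  have := DD d dD; rewrite inE => /andP[pd dq]; split=> //.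
  exact: leq_ltn_trans (left_end_le d) dq.
pose D1 := D :&: crossing r; pose D2 := D :\: crossing r.
have D1U z : z \in D1 -> z \in U.
  by case/setIP=> zD zK; apply: (subsetP KU); apply/setIP.
have splitD : #|phi @: D1| + #|phi @: D2| <= #|phi @: D|.
  have dis : phi @: D1 :&: phi @: D2 = set0.
    apply/setP => x; rewrite [RHS]inE; apply/negP => /setIP[/imsetP[v vD1 ->]].
    case/imsetP => w /setDP[wD wK] /esym/(phiU v w (D1U v vD1) wD) wv.
    by move: vD1 wK; rewrite wv => /setIP[_ ->].
  by rewrite -cardsUI dis cards0 addn0 -imsetU setID.
have -> : #|D1| = #|phi @: D1|.
  rewrite card_in_imset // => v w vD wD vw; apply: phiU vw; first exact: D1U.
  by case/setIP: vD.
apply: leq_trans splitD; rewrite leq_add2l.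
apply/bigmax_leqP => z; rewrite eS' -/D2 => zD2.
have [zK zD] : z \notin crossing r /\ z \in D by apply/andP; rewrite -in_setD.
have := DD z zD; rewrite inE => /andP[pz zq].
(* Both sides at once. A region on the left of [r] misses [d], which starts at [r]; one on the right
   misses [e], which ends before [r]. Hence the size drops below that of [D]. *)
have sub (A' B' : V * V) p' q' : is_crossing A' p' -> is_crossing B' q' ->
    p <= p' -> q' <= q -> z \in between p' q' ->
    (between p' q' :&: crossing r = set0) -> (e \notin between p' q') || (d \notin between p' q') ->
    F A' B' z <= #|phi @: D2|.
  move=> eA' eB' pp' qq' zb disj miss.
  have zA := subsetP (between_area eA' eB') z zb.
  have Rb := region_between eA' eB' zb.
  have RD : region A' B' z \subset D.
    rewrite -(eq_component zD : component G (area A B) z = D).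
    apply: sub_component.
    - apply: subset_trans Rb (subset_trans _ (between_area eA eB)).
      apply/subsetP => x; rewrite !inE => /andP[h1 h2].
      by rewrite (leq_trans pp' h1) (leq_trans h2 qq').
    - exact: component_conn.
    - exact: mem_component.
  have RD2 : region A' B' z \subset D2.
    by rewrite subsetD RD -setI_eq0 -subset0 -disj setSI.
  apply: (@leq_trans #|phi @: region A' B' z|); last first.
    by apply/subset_leq_card/imsetS.
  apply: (Ft _ _ _ _ p' q') => //; last exact: centered_onS Dc.
  rewrite -ltnS; apply: leq_trans Dt; apply/proper_card/properP; split=> //.
  by case/orP: miss => m; [exists e | exists d] => //; apply: contra m => /(subsetP Rb).
rewrite geq_min; case: (split_crossing zK) => zr.
  apply/orP; left; apply: (sub A S p r) => //.
  - exact: ltnW.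
  - by rewrite inE pz.
  - apply/setP => x; rewrite !inE; apply/negP => /andP[/andP[_ xr] /andP[rx _]].
    by rewrite ltnNge rx in xr.
  - by apply/orP; right; rewrite inE negb_and -!leqNgt left_end_le orbT.
apply/orP; right; apply: (sub S B r q) => //.
- by rewrite inE zr.
- apply/setP => x; rewrite !inE; apply/negP => /andP[/andP[rx _] /andP[_ xr]].
  by rewrite ltnNge rx in xr.
- apply/orP; left; rewrite inE negb_and -ltnNge.
  by rewrite (leq_ltn_trans (left_end_le e) ep).
Qed.

End Separators.

(** * A language of bounded loops on the random access machine *)

(* The number of vertices is kept in register 1, which no statement assigns;
   [Scale] multiplies by it and loops run that many times. *)
Inductive expr :=
  | Var of nat
  | Lit of nat
  | Plus of expr & expr
  | Minus of expr & expr
  | Scale of expr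
  | Read of expr.

Inductive stmt :=
  | Assign of nat & expr
  | Write of expr & expr
  | Then of stmt & stmt
  | Cond of expr & stmt & stmt
  | For of nat & stmt.

Fixpoint eval (e : expr) (s : state) : nat :=
  match e with
  | Var i => register s i
  | Lit c => c
  | Plus e1 e2 => eval e1 s + eval e2 s
  | Minus e1 e2 => eval e1 s - eval e2 s
  | Scale e => eval e s * register s 1
  | Read e => cell s (eval e s)
  end.

Fixpoint run (c : stmt) (s : state) : state :=
  match c with
  | Assign i e => set_reg s i (eval e s)
  | Write a e => set_cell s (eval a s) (eval e s)
  | Then c1 c2 => run c2 (run c1 s)
  | Cond e c1 c2 => if eval e s != 0 then run c1 s else run c2 s
  | For i c => iteri (register s 1) (fun j s' => run c (set_reg s' i j)) s
  end.

(** The value ends in register [t]; registers below [t] are preserved and those above are scratch. A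
    copy is an addition to zero, a product a repeated addition. *)
Fixpoint expr_code (e : expr) (t : nat) : prog :=
  match e with
  | Var i => Seq (Const t 0) (Add t i t)
  | Lit c => Const t c
  | Plus e1 e2 =>
      Seq (expr_code e1 t) (Seq (expr_code e2 t.+1) (Add t t t.+1))
  | Minus e1 e2 =>
      Seq (expr_code e1 t) (Seq (expr_code e2 t.+1) (Subtract t t t.+1))
  | Scale e =>
      Seq (expr_code e t.+1) (Seq (Const t 0) (Seq (Const t.+2 0)
     (Seq (Add t.+2 1 t.+2) (Seq (Const t.+3 1)
     (While t.+2 (Seq (Add t t t.+1) (Subtract t.+2 t.+2 t.+3)))))))
  | Read e => Seq (expr_code e t) (Fetch t t)
  end.

(** In a loop, [t] counts the remaining rounds, [t.+1] holds the index and [t.+2] the constant one;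
    the scratch space of the body begins at [t.+3]. *)
Fixpoint stmt_code (c : stmt) (t : nat) : prog :=
  match c with
  | Assign i e => Seq (expr_code e t) (Seq (Const i 0) (Add i i t))
  | Write a e =>
      Seq (expr_code a t) (Seq (expr_code e t.+1) (Store t t.+1))
  | Then c1 c2 => Seq (stmt_code c1 t) (stmt_code c2 t)
  | Cond e c1 c2 => Seq (expr_code e t) (If t (stmt_code c1 t) (stmt_code c2 t))
  | For i c =>
      Seq (Const t 0) (Seq (Add t 1 t) (Seq (Const t.+1 0)
     (While t (Seq (Const i 0) (Seq (Add i i t.+1) (Seq (stmt_code c t.+3)
     (Seq (Const t.+2 1) (Seq (Add t.+1 t.+1 t.+2) (Subtract t t t.+2)))))))))
  end.

(** For [Scale], a round costs two instructions and a test; the constant 5 is made of four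
    preparatory instructions and the final test. *)
Fixpoint expr_cost (e : expr) (n : nat) : nat :=
  match e with
  | Var _ => 2
  | Lit _ => 1
  | Plus e1 e2 | Minus e1 e2 => expr_cost e1 n + expr_cost e2 n + 1
  | Scale e => expr_cost e n + (n * 3 + 5)
  | Read e => expr_cost e n + 1
  end.

Fixpoint stmt_cost (c : stmt) (n : nat) : nat :=
  match c with
  | Assign _ e => expr_cost e n + 2
  | Write a e => expr_cost a n + expr_cost e n + 1
  | Then c1 c2 => stmt_cost c1 n + stmt_cost c2 n
  | Cond e c1 c2 => expr_cost e n + (stmt_cost c1 n + stmt_cost c2 n) + 1
  | For _ c => n * (stmt_cost c n + 6) + 4
  end.

Fixpoint expr_vars (e : expr) : seq nat :=
  match e with
  | Var i => [:: i]
  | Lit _ => [::]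
  | Plus e1 e2 | Minus e1 e2 => expr_vars e1 ++ expr_vars e2
  | Scale e | Read e => expr_vars e
  end.

Fixpoint assigned (c : stmt) : seq nat :=
  match c with
  | Assign i _ => [:: i]
  | Write _ _ => [::]
  | Then c1 c2 | Cond _ c1 c2 => assigned c1 ++ assigned c2
  | For i c => i :: assigned c
  end.

Fixpoint used (c : stmt) : seq nat :=
  match c with
  | Assign i e => i :: expr_vars e
  | Write a e => expr_vars a ++ expr_vars e
  | Then c1 c2 => used c1 ++ used c2
  | Cond e c1 c2 => expr_vars e ++ used c1 ++ used c2
  | For i c => i :: used c
  end.

Lemma reg_set s i a j :
  register (set_reg s i a) j = if j == i then a else register s j.
Proof. by []. Qed.

Lemma cell_set s i a j :
  cell (set_cell s i a) j = if j == i then a else cell s j.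
Proof. by []. Qed.

Lemma run_frame c s i : i \notin assigned c -> register (run c s) i = register s i.
Proof.
elim: c s => [j e|a e|c1 IH1 c2 IH2|e c1 IH1 c2 IH2|j c IH] s /=.
- by rewrite inE => /negbTE ->.
- by [].
- by rewrite mem_cat negb_or => /andP[h1 h2]; rewrite IH2 ?IH1.
- by rewrite mem_cat negb_or => /andP[h1 h2]; case: ifP => _; rewrite ?IH1 ?IH2.
rewrite inE negb_or => /andP[/negbTE ij ic].
by elim: (register s 1) => //= m IHm; rewrite IH //= ij.
Qed.


(** * Costs and correctness of the translation *)

Definition agree t (s s' : state) :=
  (forall i, i < t -> register s i = register s' i) /\ cell s =1 cell s'.

Lemma eval_agree t e s s' : all (gtn t) (expr_vars e) -> 1 < t ->
  agree t s s' -> eval e s = eval e s'.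
Proof.
move=> + t1 [rs cs]; elim: e => [i|c|e1 IH1 e2 IH2|e1 IH1 e2 IH2|e IH|e IH] //=.
- by rewrite andbT => /rs.
- by rewrite all_cat => /andP[/IH1-> /IH2->].
- by rewrite all_cat => /andP[/IH1-> /IH2->].
- by move=> /IH->; rewrite rs.
- by move=> /IH->; rewrite cs.
Qed.

(** Multiplication and [For] are both compiled to such a loop. Each round pays one unit for its
    test, and the last unit is the test that fails. *)
Lemma exec_countdown r A (I : nat -> state -> Prop) m b s :
    (forall j s, j < m -> I j s -> register s r = m - j ->
      exists t s', [/\ exec A s t s', t <= b, I j.+1 s' & register s' r = m - j.+1]) ->
    I 0 s -> register s r = m ->
  exists t s', [/\ exec (While r A) s t s', t <= m * b.+1 + 1, I m s'
    & register s' r = 0].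
Proof.
move=> step; suff gen d j s' : d + j = m -> I j s' -> register s' r = d ->
    exists t s'', [/\ exec (While r A) s' t s'', t <= d * b.+1 + 1, I m s''
      & register s'' r = 0].
  by move=> I0 sr; apply: gen I0 sr; rewrite addn0.
elim: d j s' => [|d IHd] j s' e Ij rd.
  by exists 1, s'; split=> //; [apply: exec_while_false | rewrite -e].
have jm : j < m by lia.
have rj : register s' r = m - j by lia.
have [t [s'' [ex tb Ij' rd']]] := step j s' jm Ij rj.
have e' : d + j.+1 = m by lia.
have rd2 : register s'' r = d by lia.
have [t' [s3 [ex' tb' Im r0]]] := IHd j.+1 s'' e' Ij' rd2.
exists (t + t').+1, s3; split=> //; last by nia.
by apply: exec_while_true ex ex'; rewrite rd.
Qed.

Lemma expr_codeP e t s : all (gtn t) (expr_vars e) -> 1 < t ->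
  exists T s', [/\ exec (expr_code e t) s T s', T <= expr_cost e (register s 1),
    register s' t = eval e s, forall i, i < t -> register s' i = register s i
    & cell s' = cell s].
Proof.
have binary e1 e2 op f :
    (forall t s, all (gtn t) (expr_vars e1) -> 1 < t ->
      exists T s', [/\ exec (expr_code e1 t) s T s',
        T <= expr_cost e1 (register s 1), register s' t = eval e1 s,
        forall i, i < t -> register s' i = register s i & cell s' = cell s]) ->
    (forall t s, all (gtn t) (expr_vars e2) -> 1 < t ->
      exists T s', [/\ exec (expr_code e2 t) s T s',
        T <= expr_cost e2 (register s 1), register s' t = eval e2 s,
        forall i, i < t -> register s' i = register s i & cell s' = cell s]) ->
    (forall i j l s, exec (op i j l) s 1 (set_reg s i (f (register s j) (register s l)))) ->
    forall t s, all (gtn t) (expr_vars e1 ++ expr_vars e2) -> 1 < t ->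
  exists T s', [/\
    exec (Seq (expr_code e1 t) (Seq (expr_code e2 t.+1) (op t t t.+1))) s T s',
    T <= expr_cost e1 (register s 1) + expr_cost e2 (register s 1) + 1,
    register s' t = f (eval e1 s) (eval e2 s),
    forall i, i < t -> register s' i = register s i & cell s' = cell s].
  move=> IH1 IH2 ex t1 s1; rewrite all_cat => /andP[v1 v2] lt1.
  have [T1 [s2 [ex1 le1 r1 f1 c1]]] := IH1 t1 s1 v1 lt1.
  have v2' : all (gtn t1.+1) (expr_vars e2) by apply: sub_all v2 => i /ltnW.
  have [T2 [s3 [ex2 le2 r2 f2 c2]]] := IH2 t1.+1 s2 v2' (ltnW lt1).
  exists (T1 + (T2 + 1)); eexists; split.
  - exact: exec_seq ex1 (exec_seq ex2 (ex _ _ _ _)).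
  - by rewrite f1 // in le2; lia.
  - rewrite reg_set eqxx r2 f2 // r1; congr (f _ _).
    by apply: eval_agree v2 lt1 _; split=> // j; rewrite c1.
  - by move=> j jt; rewrite reg_set (ltn_eqF jt) f2 ?f1 // ltnW.
  - by rewrite /= c2.
elim: e t s => [i|c|e1 IH1 e2 IH2|e1 IH1 e2 IH2|e IH|e IH] t s /=.
- rewrite andbT => it t1; exists (1 + 1); eexists; split.
  + exact: exec_seq (exec_const _ _ _) (exec_add _ _ _ _).
  + by [].
  + by rewrite !reg_set !eqxx (ltn_eqF it) addn0.
  + by move=> j jt; rewrite !reg_set (ltn_eqF jt).
  + by [].
- move=> _ t1; exists 1; eexists; split; first exact: exec_const.
  + by [].
  + by rewrite reg_set eqxx.
  + by move=> j jt; rewrite !reg_set (ltn_eqF jt).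
  + by [].
- exact: (binary _ _ Add addn IH1 IH2 (fun i j l s => exec_add s i j l)).
- exact: (binary _ _ Subtract subn IH1 IH2 (fun i j l s => exec_subtract s i j l)).
- move=> v t1; have v' : all (gtn t.+1) (expr_vars e) by apply: sub_all v => i /ltnW.
  have [T1 [s1 [ex1 le1 r1 f1 c1]]] := IH t.+1 s v' (ltnW t1).
  pose s2 := set_reg (set_reg (set_reg (set_reg s1 t 0) t.+2 0) t.+2 (register s 1)) t.+3 1.
  pose I j s' := [/\ register s' t = eval e s * j, register s' t.+1 = eval e s,
    register s' t.+3 = 1, (forall i, i < t -> register s' i = register s i)
    & cell s' = cell s].
  have [j s3 jn [i1 i2 i3 i4 i5] i6||| T [s3 [ex3 le3 [i1 i2 i3 i4 i5] i6]]] :=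
      @exec_countdown t.+2 (Seq (Add t t t.+1) (Subtract t.+2 t.+2 t.+3)) I
        (register s 1) 2 s2.
  + exists (1 + 1); eexists; split.
    * exact: exec_seq (exec_add _ _ _ _) (exec_subtract _ _ _ _).
    * by [].
    * split=> [||||//]; rewrite ?reg_set.
      - by rewrite eqxx ifN ?i1 ?i2; lia.
      - by rewrite !ifN ?i2; lia.
      - by rewrite !ifN ?i3; lia.
      - by move=> i it; rewrite !reg_set !ifN ?i4; lia.
    * rewrite !reg_set eqxx i6 !ifN ?i3; lia.
  + rewrite /I /s2; split=> [||||//]; rewrite ?reg_set.
    * by rewrite eqxx !ifN ?muln0 //; lia.
    * by rewrite !ifN ?r1; lia.
    * by rewrite eqxx.
    * by move=> i it; rewrite !reg_set !ifN ?f1; lia.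
  + by rewrite /s2 !reg_set eqxx ifN; lia.
  exists (T1 + (1 + (1 + (1 + (1 + T))))), s3; split=> //; last by lia.
  apply: exec_seq ex1 _; apply: exec_seq (exec_const _ _ _) _.
  apply: exec_seq (exec_const _ _ _) _.
  apply: exec_seq (exec_add _ _ _ _) _.
  have -> : register (set_reg (set_reg s1 t 0) t.+2 0) 1
      + register (set_reg (set_reg s1 t 0) t.+2 0) t.+2 = register s 1.
    by rewrite !reg_set eqxx !ifN ?f1; lia.
  exact: exec_seq (exec_const _ _ _) ex3.
- move=> v t1; have [T1 [s1 [ex1 le1 r1 f1 c1]]] := IH t s v t1.
  exists (T1 + 1); eexists; split.
  + exact: exec_seq ex1 (exec_fetch _ _ _).
  + by lia.
  + by rewrite reg_set eqxx r1 c1.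
  + by move=> j jt; rewrite reg_set (ltn_eqF jt) f1.
  + by rewrite /= c1.
Qed.

(** [B] separates program variables from scratch registers, and [t] is the first free one.
    Preserving the registers from [B] up to [t] protects the counters of the enclosing loops. *)
Lemma stmt_codeP c B t s s' : all (gtn B) (used c) -> 1 \notin assigned c ->
  1 < B -> B <= t -> agree B s s' ->
  exists T s'', [/\ exec (stmt_code c t) s T s'', T <= stmt_cost c (register s 1),
    agree B s'' (run c s')
    & forall i, B <= i < t -> register s'' i = register s i].
Proof.
move=> + + B1; elim: c t s s' => [j e|a e|c1 IH1 c2 IH2|e c1 IH1 c2 IH2|j c IH] t s s' /=.
- move=> /andP[jB v] _ Bt ag; have t1 : 1 < t by lia.
  have vt : all (gtn t) (expr_vars e) by apply: sub_all v => i /leq_trans; apply.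
  have [T1 [s1 [ex1 le1 r1 f1 c1]]] := expr_codeP s vt t1.
  exists (T1 + (1 + 1)); eexists; split.
  + apply: exec_seq ex1 (exec_seq (exec_const _ _ _) (exec_add _ _ _ _)).
  + by lia.
  + split=> [i iB|i] /=; last by rewrite c1; apply: ag.2.
    case: eqP => // ij.
      rewrite eqxx ifN ?add0n; last by lia.
      by rewrite r1; apply: eval_agree v B1 ag.
    by rewrite f1 ?ag.1 //; lia.
  + by move=> i /andP[Bi it]; rewrite !reg_set !ifN ?f1 //; lia.
- rewrite all_cat => /andP[va v] _ Bt ag; have t1 : 1 < t by lia.
  have vt : all (gtn t) (expr_vars a) by apply: sub_all va => i /leq_trans; apply.
  have [T1 [s1 [ex1 le1 r1 f1 c1]]] := expr_codeP s vt t1.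
  have vt2 : all (gtn t.+1) (expr_vars e).
    by apply: sub_all v => i /leq_trans; apply; apply: leqW.
  have [T2 [s2 [ex2 le2 r2 f2 c2]]] := expr_codeP s1 vt2 (ltnW t1).
  have ag1 : agree B s1 s'.
    by split=> [i iB|i]; rewrite ?c1 ?ag.2 // f1 ?ag.1 //; lia.
  exists (T1 + (T2 + 1)); eexists; split.
  + apply: exec_seq ex1 (exec_seq ex2 (exec_store _ _ _)).
  + by rewrite f1 // in le2; lia.
  + rewrite r2 (f2 t) // r1 (eval_agree va B1 ag) (eval_agree v B1 ag1).
    split=> [i iB|i] /=; last by rewrite c2 ag1.2.
    by rewrite f2 ?ag1.1 //; lia.
  + by move=> i /andP[Bi it] /=; rewrite f2 ?f1 //; lia.
- rewrite all_cat mem_cat negb_or => /andP[v1 v2] /andP[n1 n2] Bt ag.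
  have [T1 [s1 [ex1 le1 ag1 f1]]] := IH1 t s s' v1 n1 Bt ag.
  have [T2 [s2 [ex2 le2 ag2 f2]]] := IH2 t s1 _ v2 n2 Bt ag1.
  exists (T1 + T2), s2; split=> //.
  + exact: exec_seq ex1 ex2.
  + have -> : register s 1 = register s1 1 by rewrite ag1.1 // run_frame // -ag.1.
    by rewrite ag1.1 // run_frame // -ag.1 // in le2 *; lia.
  + by move=> i bi; rewrite f2 ?f1.
- rewrite !all_cat mem_cat negb_or => /and3P[v v1 v2] /andP[n1 n2] Bt ag.
  have t1 : 1 < t by lia.
  have vt : all (gtn t) (expr_vars e) by apply: sub_all v => i /leq_trans; apply.
  have [T0 [s0 [ex0 le0 r0 f0 c0]]] := expr_codeP s vt t1.
  have ag0 : agree B s0 s'.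
    by split=> [i iB|i]; rewrite ?c0 ?ag.2 // f0 ?ag.1 //; lia.
  rewrite -(eval_agree v B1 ag) -r0.
  case: ifP => [r|/negbFE/eqP r].
    have [T1 [s1 [ex1 le1 ag1 f1]]] := IH1 t s0 s' v1 n1 Bt ag0.
    exists (T0 + T1.+1), s1; split=> //.
    + by apply: exec_seq ex0 (exec_if_true _ r ex1).
    + by rewrite f0 // in le1; lia.
    + by move=> i bi; rewrite f1 ?f0 //; lia.
  have [T1 [s1 [ex1 le1 ag1 f1]]] := IH2 t s0 s' v2 n2 Bt ag0.
  exists (T0 + T1.+1), s1; split=> //.
  + by apply: exec_seq ex0 (exec_if_false _ r ex1).
  + by rewrite f0 // in le1; lia.
  + by move=> i bi; rewrite f1 ?f0 //; lia.
move=> /andP[jB v]; rewrite inE negb_or => /andP[j1 n1] Bt ag.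
pose n := register s 1.
pose s1 := set_reg (set_reg (set_reg s t 0) t n) t.+1 0.
pose R m := iteri m (fun j' s' => run c (set_reg s' j j')) s'.
pose I m σ := [/\ agree B σ (R m), register σ t.+1 = m, register σ 1 = n
  & forall i, B <= i < t -> register σ i = register s i].
have [m σ mn [i1 i2 i3 i4] i5||| T [s3 [ex3 le3 [i1 i2 i3 i4] i5]]] :=
  @exec_countdown t (Seq (Const j 0) (Seq (Add j j t.+1) (Seq (stmt_code c t.+3)
     (Seq (Const t.+2 1) (Seq (Add t.+1 t.+1 t.+2) (Subtract t t t.+2)))))) I
        n (stmt_cost c n + 5) s1.
- pose σ1 := set_reg (set_reg σ j 0) j m.
  have ag1 : agree B σ1 (set_reg (R m) j m).
    split=> [i iB|i] /=; last exact: i1.2.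
    by case: eqP => // _; apply: i1.1.
  have Bt3 : B <= t.+3 by lia.
  have [T2 [s2 [ex2 le2 ag2 f2]]] := IH t.+3 σ1 _ v n1 Bt3 ag1.
  exists (1 + (1 + (T2 + (1 + (1 + 1))))); eexists; split.
  + apply: exec_seq (exec_const _ _ _) _; apply: exec_seq (exec_add _ _ _ _) _.
    rewrite !reg_set eqxx ifN; last by lia.
    rewrite add0n i2; apply: exec_seq ex2 _.
    exact: exec_seq (exec_const _ _ _) (exec_seq (exec_add _ _ _ _) (exec_subtract _ _ _ _)).
  + have e1 : register σ1 1 = n by rewrite /σ1 !reg_set !ifN //; lia.
    by rewrite e1 in le2; lia.
  + split.
    * split=> [i iB|i] /=; last by rewrite ag2.2.
      by rewrite !ifN ?ag2.1 //; lia.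
    * by rewrite !reg_set !eqxx !ifN ?f2 /= ?ifN ?i2; lia.
    * rewrite !reg_set !ifN ?ag2.1 ?run_frame //=; try lia.
      by rewrite ifN -?i1.1 ?i3 // eq_sym; apply/eqP => e; rewrite e eqxx in j1.
    * by move=> i bi; rewrite !reg_set !ifN ?f2 /= ?ifN ?i4 //; lia.
  + by rewrite !reg_set !eqxx !ifN ?f2 /= ?ifN ?i5; lia.
- split=> //.
  + split=> [i iB|i] /=; last exact: ag.2.
    by rewrite !ifN ?ag.1 //; lia.
  + by rewrite !reg_set eqxx.
  + by rewrite !reg_set !ifN //; lia.
  + by move=> i bi; rewrite !reg_set !ifN //; lia.
- by rewrite /s1 !reg_set eqxx ifN; lia.
exists (1 + (1 + (1 + T))), s3; split=> //.
- apply: exec_seq (exec_const _ _ _) _; apply: exec_seq (exec_add _ _ _ _) _.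
  rewrite !reg_set eqxx ifN ?addn0; last by lia.
  exact: exec_seq (exec_const _ _ _) ex3.
- by rewrite -/n; nia.
- by rewrite -ag.1.
Qed.

(** * Polynomial costs *)

Definition polynomial (f : nat -> nat) :=
  exists p : {poly nat}, forall n, f n = (p.[n])%R.

Lemma polynomial_const c : polynomial (fun=> c).
Proof. by exists (c%:P)%R => n; rewrite hornerC. Qed.

Lemma polynomial_id : polynomial id.
Proof. by exists 'X%R => n; rewrite hornerX. Qed.

Lemma polynomialD f g :
  polynomial f -> polynomial g -> polynomial (fun n => f n + g n).
Proof.
by move=> [p fp] [q gq]; exists (p + q)%R => n; rewrite hornerD fp gq.
Qed.

Lemma polynomialM f g :
  polynomial f -> polynomial g -> polynomial (fun n => f n * g n).
Proof.
by move=> [p fp] [q gq]; exists (p * q)%R => n; rewrite hornerM fp gq.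
Qed.

Lemma expr_cost_polynomial e : polynomial (expr_cost e).
Proof.
elim: e => [i|c|e1 IH1 e2 IH2|e1 IH1 e2 IH2|e IH|e IH] /=.
- exact: polynomial_const.
- exact: polynomial_const.
- exact: polynomialD (polynomialD _ _) (polynomial_const _).
- exact: polynomialD (polynomialD _ _) (polynomial_const _).
- apply: polynomialD => //; apply: polynomialD (polynomial_const _).
  exact: polynomialM polynomial_id (polynomial_const _).
- exact: polynomialD (polynomial_const _).
Qed.

Lemma stmt_cost_polynomial c : polynomial (stmt_cost c).
Proof.
elim: c => [i e|a e|c1 IH1 c2 IH2|e c1 IH1 c2 IH2|i c IH] /=.
- exact: polynomialD (expr_cost_polynomial _) (polynomial_const _).
- by apply: polynomialD (polynomialD _ _) (polynomial_const _);
    apply: expr_cost_polynomial.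
- exact: polynomialD.
- apply: polynomialD (polynomial_const _).
  by apply: polynomialD (polynomialD _ _) => //; apply: expr_cost_polynomial.
- apply: polynomialD (polynomial_const _); apply: polynomialM polynomial_id _.
  exact: polynomialD IH (polynomial_const _).
Qed.

(** Natural coefficients make evaluation monotone, which turns a cost in the number of vertices into
    a bound in the bit length of the input. *)
Lemma leq_horner (p : {poly nat}) m n : m <= n -> (p.[m] <= p.[n])%N%R.
Proof.
move=> mn; rewrite !horner_coef; elim/big_ind2: _ => [//|a b c d|i _].
  exact: leq_add.
apply: leq_mul => //; elim: (i : nat) => [|j IHj]; first by rewrite !GRing.expr0.
by rewrite !GRing.exprS leq_mul.
Qed.


(** * The program *)

(** Truth values are 0 and 1, combined by truncated subtraction. [And] presupposes such operands,
    whereas [Not] tests any number for zero; the double [Not] in [Neq] reduces a distance to 0 or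
    1. *)
Definition Not e := Minus (Lit 1) e.
Definition And e1 e2 := Minus (Plus e1 e2) (Lit 1).
Definition Neq e1 e2 := Not (Not (Plus (Minus e1 e2) (Minus e2 e1))).
Definition Max e1 e2 := Plus e1 (Minus e2 e1).
Definition Min e1 e2 := Minus e1 (Minus e1 e2).

(* The input stays in place. The tables follow it, at the address given by
   register 0; [t] is 0 for the bounds, 1 for the colors and 2 for the marks. *)
Definition edge u v := Read (Plus (Lit 1) (Plus (Scale (Var u)) (Var v))).

Definition slot t a b c d z :=
  Plus (Var 0) (Plus (Scale (Plus (Scale (Plus (Scale (Plus (Scale (Plus
    (Scale (Lit t)) a)) b)) c)) d)) z).

Definition entry t (p q : nat * nat) z :=
  slot t (Var p.1) (Var p.2) (Var q.1) (Var q.2) (Var z).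

Definition mark z := slot 2 (Lit 0) (Lit 0) (Lit 0) (Lit 0) (Var z).

Definition in_common (p : nat * nat) z := And (edge p.1 z) (edge p.2 z).
Definition in_barrier p z := And (Neq (Var p.1) (Var p.2)) (in_common p z).
Definition in_cut p z := Not (And (Neq (Var p.1) (Var p.2)) (Not (in_common p z))).
Definition in_area p q z := And (Not (in_barrier p z)) (Not (in_barrier q z)).

(** A dummy instruction: no expression of the program reads register 16. *)
Definition skip := Assign 16 (Lit 0).

Local Notation rA := (2, 3).
Local Notation rB := (4, 5).
Local Notation ry := 6.
Local Notation rS := (7, 8).
Local Notation rz := 9.
Local Notation ru := 10.
Local Notation rcount := 11.
Local Notation rrest := 12.
Local Notation rindex := 13.
Local Notation rdist := 14.
Local Notation rround := 15.

Definition spread :=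
  Cond (And (Read (mark ru)) (And (edge ru rz) (in_area rA rB rz)))
    (Write (mark rz) (Lit 1)) skip.

(** Graph search by repeated relaxation over all pairs. One round advances by at least one edge, so
    [n] rounds outlast every simple path. *)
Definition mark_region :=
  Then (For rz (Write (mark rz) (Lit 0)))
 (Then (Write (mark ry) (Lit 1))
       (For rdist (For ru (For rz spread)))).

Definition measure :=
  Then (Assign rcount (Lit 0))
 (Then (Assign rrest (Lit 0))
       (For rz (Cond (Read (mark rz))
          (Cond (in_cut rS rz)
             (Assign rcount (Plus (Var rcount) (Lit 1)))
             (Assign rrest (Max (Var rrest)
                (Min (Read (entry 0 rA rS rz)) (Read (entry 0 rS rB rz))))))
          skip))).

(* [rS] may equal [rA] or [rB]; this is harmless because step [z] reads and
   writes table entries with last index [z] only, and reads them first. *)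
Definition recolor :=
  Then (Assign rindex (Lit 0))
       (For rz (Cond (Read (mark rz))
          (Then
             (Cond (in_cut rS rz)
                (Then (Write (entry 1 rA rB rz) (Plus (Var rrest) (Var rindex)))
                      (Assign rindex (Plus (Var rindex) (Lit 1))))
                (Cond (Minus (Read (entry 0 rA rS rz)) (Read (entry 0 rS rB rz)))
                   (Write (entry 1 rA rB rz) (Read (entry 1 rS rB rz)))
                   (Write (entry 1 rA rB rz) (Read (entry 1 rA rS rz)))))
             (Write (entry 0 rA rB rz) (Plus (Var rcount) (Var rrest))))
          skip)).

Definition improve :=
  Then measure
       (Cond (Minus (Read (entry 0 rA rB ry)) (Plus (Var rcount) (Var rrest)))
          recolor skip).

Definition improve_region :=
  Cond (in_area rA rB ry)
    (Then mark_region (For rS.1 (For rS.2 improve))) skip.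

Definition for_bounds c := For rA.1 (For rA.2 (For rB.1 (For rB.2 c))).

Definition pass := for_bounds (For ry improve_region).

Definition setup :=
  for_bounds (For rz
    (Then (Write (entry 0 rA rB rz) (Var 1)) (Write (entry 1 rA rB rz) (Var rz)))).

(** The pair of equal vertices [(0, 0)] on both sides sets no barrier, so its entries concern the
    whole graph. Register 0 is the base address of the tables and can receive the output length only
    at the very end. *)
Definition report :=
  Then (Then (Assign rA.1 (Lit 0)) (Then (Assign rA.2 (Lit 0))
       (Then (Assign rB.1 (Lit 0)) (Assign rB.2 (Lit 0)))))
 (Then (Assign rrest (Lit 0))
 (Then (For rz (Assign rrest (Max (Var rrest) (Read (entry 0 rA rB rz)))))
 (Then (For rz (Write (Plus (Lit 1) (Var rz)) (Plus (Read (entry 1 rA rB rz)) (Lit 1))))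
 (Then (Write (Lit 0) (Var rrest))
       (Assign 0 (Plus (Var 1) (Lit 1))))))).

Definition main := Then setup (Then (For rround pass) report).

(** * Correctness of the program *)

Lemma For_ind i c s (J : nat -> state -> Prop) :
    J 0 s ->
    (forall j s', j < register s 1 -> J j s' ->
       (forall r, r \notin i :: assigned c -> register s' r = register s r) ->
       J j.+1 (run c (set_reg s' i j))) ->
  J (register s 1) (run (For i c) s).
Proof.
move=> J0 Js /=; set R := iteri _ _.
suff: forall m, m <= register s 1 ->
    J m (iteri m (fun j s' => run c (set_reg s' i j)) s) /\
    forall r, r \notin i :: assigned c ->
      register (iteri m (fun j s' => run c (set_reg s' i j)) s) r = register s r.
  by move=> /(_ _ (leqnn _))[].
elim=> [//|m IHm] mn; have [Jm fr] := IHm (ltnW mn); split; first exact: Js.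
move=> r rn /=; move: (rn); rewrite inE negb_or => /andP[/negbTE ri rc].
by rewrite run_frame //= ri fr.
Qed.

Section Nested.

Variables (n : nat) (I : state -> Prop) (le : state -> state -> Prop).
Hypothesis I_n : forall s, I s -> register s 1 = n.
Hypothesis I_set : forall s i j, 1 < i -> I s -> I (set_reg s i j).
Hypothesis le_refl : forall s, le s s.
Hypothesis le_set : forall s i j, le s (set_reg s i j).
Hypothesis le_trans : forall s1 s2 s3, le s1 s2 -> le s2 s3 -> le s1 s3.

Definition holds (P : seq (nat * nat)) s :=
  all (fun ij => register s ij.1 == ij.2) P.

(** [I] is an invariant, [P] lists the current values of the enclosing loop variables, and [le] is a
    preorder along which execution progresses: marks grow, or bounds drop. *)
Definition achieves P c (Q : state -> Prop) := forall s, I s -> holds P s ->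
  [/\ I (run c s), le s (run c s) & Q (run c s)].

Definition stable (Q : state -> Prop) := forall s s', le s s' -> Q s -> Q s'.

Lemma stable_forall (T : Type) (Q : T -> state -> Prop) :
  (forall j, stable (Q j)) -> stable (fun s => forall j, Q j s).
Proof. by move=> st s s' ss' Qs j; apply: st ss' (Qs j). Qed.

(** What a round secures is preserved by the progress of the later rounds, so all the postconditions
    hold together at the end. *)
Lemma achieves_For P i c (Q : 'I_n -> state -> Prop) :
    1 < i -> all (fun ij => ij.1 \notin i :: assigned c) P ->
    (forall j, stable (Q j)) ->
    (forall j : 'I_n, achieves ((i, j : nat) :: P) c (Q j)) ->
  achieves P (For i c) (fun s => forall j, Q j s).
Proof.
move=> i1 fresh st step s Is Ps; have n1 := I_n Is.
have [|j s' jn [Is' les' Qs'] fr|I' le' Q'] := @For_ind i c s (fun j s' =>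
  [/\ I s', le s s' & forall j' : 'I_n, j' < j -> Q j' s']).
- by split.
- rewrite n1 in jn; have [||Is2 le2 Q2] := step (Ordinal jn) (set_reg s' i j).
  + exact: I_set.
  + rewrite /holds /= !eqxx /= ?eqxx /=; apply/allP => -[r v] rP /=.
    have rf : r \notin i :: assigned c := allP fresh _ rP.
    rewrite ifN; last by move: rf; rewrite inE negb_or => /andP[].
    by rewrite fr //; apply: (allP Ps) rP.
  have le3 : le s' (run c (set_reg s' i j)) := le_trans (le_set _ _ _) le2.
  split=> // [|j']; first exact: le_trans les' le3.
  rewrite ltnS leq_eqVlt => /orP[/eqP e|j'j].
    by have -> : j' = Ordinal jn by apply: val_inj.
  exact: st le3 (Qs' j' j'j).
by split=> // j; apply: Q'; rewrite n1.
Qed.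

End Nested.

Section Verification.

Variables (n L : nat) (G : sgraph 'I_n).
Hypothesis L_large : n * n < L.
Local Notation V := 'I_n.
Implicit Types (A B S : V * V) (y z u v : V) (s : state) (X : {set V}).

Definition address t (a b c d e : nat) :=
  L + (((((t * n + a) * n + b) * n + c) * n + d) * n + e).

Lemma digit_inj a b c d : b < n -> d < n -> a * n + b = c * n + d -> a = c /\ b = d.
Proof.
move=> bn dn e; have n0 : 0 < n by apply: leq_trans bn.
have ac : a = c by have := congr1 (divn^~ n) e; rewrite !divnMDl ?divn_small ?addn0.
by split=> //; move: e; rewrite ac => /addnI.
Qed.

(** The indices are digits in base [n], with [t] as the leading one, for which no bound is
    required. *)
Lemma address_inj t a b c d e t' a' b' c' d' e' :
    [/\ a < n, b < n, c < n, d < n & e < n] ->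
    [/\ a' < n, b' < n, c' < n, d' < n & e' < n] ->
    address t a b c d e = address t' a' b' c' d' e' ->
  [/\ t = t', a = a', b = b', c = c' & d = d' /\ e = e'].
Proof.
move=> [? ? ? ? ?] [? ? ? ? ?] /addnI.
by do 5!case/digit_inj=> //; move=> -> -> -> -> -> ->.
Qed.

Definition sound s := [/\ register s 0 = L, register s 1 = n
  & forall u v, cell s (1 + (u * n + v)) = G u v].

Definition tab t s : table V :=
  fun A B z => cell s (address t A.1 A.2 B.1 B.2 z).
Local Notation bound := (tab 0).
Local Notation color := (tab 1).

Definition marks s X := forall z, cell s (address 2 0 0 0 0 z) = (z \in X).

Definition reads s (p : nat * nat) A :=
  register s p.1 = A.1 /\ register s p.2 = A.2.

Lemma sound_set_reg s i a : 1 < i -> sound s -> sound (set_reg s i a).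
Proof. by case: i => [|[|i]] // _ [s0 s1 sG]. Qed.

Lemma sound_set_cell s i a : L <= i -> sound s -> sound (set_cell s i a).
Proof.
move=> Li [s0 s1 sG]; split=> // u v; rewrite cell_set ifN ?sG //.
have := ltn_ord u; have := ltn_ord v; nia.
Qed.

Lemma address_ge t a b c d e : L <= address t a b c d e.
Proof. exact: leq_addr. Qed.

Lemma tab_set_tab t t' s A B z a A' B' z' :
  tab t' (set_cell s (address t A.1 A.2 B.1 B.2 z) a) A' B' z' =
    if [&& t' == t, A' == A, B' == B & z' == z] then a else tab t' s A' B' z'.
Proof.
rewrite /tab cell_set; congr (if _ then _ else _); apply/eqP/and4P => [e|]; last first.
  by case=> /eqP-> /eqP-> /eqP-> /eqP->.
have [||-> e1 e2 e3 [e4 e5]] := address_inj _ _ e; try by split.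
split=> //; first by apply/eqP; rewrite [A']surjective_pairing [A]surjective_pairing;
  congr pair; apply: val_inj.
  by apply/eqP; rewrite [B']surjective_pairing [B]surjective_pairing;
  congr pair; apply: val_inj.
exact/eqP/val_inj.
Qed.

Lemma tab_set_mark t s z a A B z' : t < 2 ->
  tab t (set_cell s (address 2 0 0 0 0 z) a) A B z' = tab t s A B z'.
Proof.
move=> t2; rewrite /tab cell_set ifN //; apply/eqP => e.
have n0 : 0 < n := leq_ltn_trans (leq0n z) (ltn_ord z).
by have [||e1] := address_inj _ _ e; rewrite ?e1 in t2.
Qed.

Lemma mark_set_tab t s A B z a z' : t < 2 ->
  cell (set_cell s (address t A.1 A.2 B.1 B.2 z) a) (address 2 0 0 0 0 z')
    = cell s (address 2 0 0 0 0 z').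
Proof.
move=> t2; rewrite cell_set ifN //; apply/eqP => e.
have n0 : 0 < n := leq_ltn_trans (leq0n z) (ltn_ord z).
by have [||e1] := address_inj _ _ e; rewrite -?e1 in t2.
Qed.

Lemma mark_set_mark s z a z' :
  cell (set_cell s (address 2 0 0 0 0 z) a) (address 2 0 0 0 0 z')
    = if z' == z then a else cell s (address 2 0 0 0 0 z').
Proof.
rewrite cell_set; congr (if _ then _ else _); apply/eqP/eqP => [e|->//].
have n0 : 0 < n := leq_ltn_trans (leq0n z) (ltn_ord z).
by have [||_ _ _ _ [_ /val_inj]] := address_inj _ _ e.
Qed.

Lemma eval_Not e s (b : bool) : eval e s = b -> eval (Not e) s = ~~ b.
Proof. by move=> /= ->; case: b. Qed.

Lemma eval_And e1 e2 s (b1 b2 : bool) :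
  eval e1 s = b1 -> eval e2 s = b2 -> eval (And e1 e2) s = b1 && b2.
Proof. by move=> /= -> ->; case: b1 b2 => [] []. Qed.

Lemma eval_Neq e1 e2 s : eval (Neq e1 e2) s = (eval e1 s != eval e2 s).
Proof. rewrite /=; lia. Qed.

Lemma eval_Max e1 e2 s : eval (Max e1 e2) s = maxn (eval e1 s) (eval e2 s).
Proof. by rewrite /= maxnE. Qed.

Lemma eval_Min e1 e2 s : eval (Min e1 e2) s = minn (eval e1 s) (eval e2 s).
Proof. by rewrite /= minnE. Qed.

Lemma eval_edge s i j u v : sound s -> register s i = u -> register s j = v ->
  eval (edge i j) s = G u v.
Proof. by move=> [s0 s1 sG] /= -> ->; rewrite s1 sG. Qed.

Lemma eval_entry_regs t s p q i A B z :
    register s 0 = L -> register s 1 = n ->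
    reads s p A -> reads s q B -> register s i = z ->
  eval (entry t p q i) s = address t A.1 A.2 B.1 B.2 z.
Proof. by move=> s0 s1 [/= -> ->] [-> ->] ->; rewrite s0 s1. Qed.

Lemma eval_entry t s p q i A B z :
    sound s -> reads s p A -> reads s q B -> register s i = z ->
  eval (entry t p q i) s = address t A.1 A.2 B.1 B.2 z.
Proof. by case=> s0 s1 _; apply: eval_entry_regs. Qed.

Lemma eval_mark s i z : sound s -> register s i = z ->
  eval (mark i) s = address 2 0 0 0 0 z.
Proof. by move=> [s0 s1 sG] /= ->; rewrite s0 s1. Qed.

Lemma eval_in_common s p i S z : sound s -> reads s p S -> register s i = z ->
  eval (in_common p i) s = (z \in common G S).
Proof.
by move=> ss [p1 p2] iz; rewrite inE; apply: eval_And; apply: eval_edge.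
Qed.

Lemma eval_in_barrier s p i S z : sound s -> reads s p S -> register s i = z ->
  eval (in_barrier p i) s = (z \in barrier G S).
Proof.
move=> ss pS iz; have -> : (z \in barrier G S) = (S.1 != S.2) && (z \in common G S).
  by rewrite /barrier; case: eqVneq; rewrite ?inE.
apply: eval_And (eval_in_common ss pS iz); rewrite eval_Neq /= pS.1 pS.2.
by rewrite -val_eqE.
Qed.

Lemma eval_in_cut s p i S z : sound s -> reads s p S -> register s i = z ->
  eval (in_cut p i) s = (z \in cut G S).
Proof.
move=> ss pS iz.
have -> : (z \in cut G S) = ~~ ((S.1 != S.2) && (z \notin common G S)).
  by rewrite /cut; case: eqVneq; rewrite ?inE ?negbK.
apply: eval_Not; apply: eval_And (eval_Not (eval_in_common ss pS iz)).
by rewrite eval_Neq /= pS.1 pS.2 -val_eqE.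
Qed.

Lemma eval_in_area s p q i A B z :
    sound s -> reads s p A -> reads s q B -> register s i = z ->
  eval (in_area p q i) s = (z \in area G A B).
Proof.
move=> ss pA qB iz; rewrite inE [z \in _ :|: _]inE negb_or.
by apply: eval_And; apply: eval_Not; apply: eval_in_barrier.
Qed.

Lemma run_Then c1 c2 s : run (Then c1 c2) s = run c2 (run c1 s).
Proof. by []. Qed.

Lemma run_Assign i e s : run (Assign i e) s = set_reg s i (eval e s).
Proof. by []. Qed.

Lemma run_Write a e s : run (Write a e) s = set_cell s (eval a s) (eval e s).
Proof. by []. Qed.

Lemma eval_Read e s : eval (Read e) s = cell s (eval e s).
Proof. by []. Qed.

Lemma eval_Minus e1 e2 s : eval (Minus e1 e2) s = eval e1 s - eval e2 s.
Proof. by []. Qed.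

Lemma run_Cond e c1 c2 s :
  run (Cond e c1 c2) s = if eval e s != 0 then run c1 s else run c2 s.
Proof. by []. Qed.

Lemma run_test e c1 c2 s (b : bool) : eval e s = b ->
  run (Cond e c1 c2) s = if b then run c1 s else run c2 s.
Proof. by move=> /= ->; case: b. Qed.

Lemma sound_frame s s' : cell s' = cell s -> register s' 0 = register s 0 ->
  register s' 1 = register s 1 -> sound s -> sound s'.
Proof. by move=> ec e0 e1 [s0 s1 sG]; split; rewrite ?ec ?e0 ?e1. Qed.

Lemma big_ltS (T : Type) (idx : T) (op : Monoid.com_law idx) (P : pred V)
    (F : V -> T) j (jn : j < n) :
  \big[op/idx]_(z | P z && (z < j.+1)) F z =
    if P (Ordinal jn) then op (F (Ordinal jn)) (\big[op/idx]_(z | P z && (z < j)) F z)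
    else \big[op/idx]_(z | P z && (z < j)) F z.
Proof.
case: ifP => Pj.
  rewrite (bigD1 (Ordinal jn)) /= ?Pj ?ltnSn //; congr (op _ _).
  apply: eq_bigl => z; rewrite ltnS leq_eqVlt -val_eqE /=.
  by case: (P z) => //=; case: ltngtP.
apply: eq_bigl => z; rewrite ltnS leq_eqVlt.
have [e|//] := eqVneq (z : nat) j; suff -> : z = Ordinal jn by rewrite Pj.
exact: val_inj.
Qed.

Lemma big_lt_n (T : Type) (idx : T) (op : Monoid.com_law idx) (P : pred V)
    (F : V -> T) :
  \big[op/idx]_(z | P z && (z < n)) F z = \big[op/idx]_(z | P z) F z.
Proof. by apply: eq_bigl => z; rewrite ltn_ord andbT. Qed.

(** The value of a counter of members of [X] when a loop reaches [j]. On [X] itself it is the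
    injective numbering that [valid_update] requires. *)
Definition rank X (j : nat) := \sum_(w | (w \in X) && (w < j)) 1.

Lemma rankE X j : rank X j = #|[set w in X | w < j]|.
Proof. by rewrite -sum1_card; apply: eq_bigl => w; rewrite inE. Qed.

Lemma rank_lt X z : z \in X -> rank X z < #|X|.
Proof.
move=> zX; rewrite rankE; apply/proper_card/properP; split.
  by apply/subsetP => w; rewrite inE => /andP[].
by exists z; rewrite // inE ltnn andbF.
Qed.

Lemma rank_inj X : {in X &, injective (fun z : V => rank X z)}.
Proof.
have mono y z : y \in X -> y < z -> rank X y < rank X z.
  move=> yX yz; rewrite !rankE; apply/proper_card/properP; split.
    by apply/subsetP => w; rewrite !inE => /andP[-> /ltn_trans]; apply.
  by exists y; rewrite !inE yX ?ltnn.
move=> y z yX zX e; apply: val_inj; case: (ltngtP y z) => //.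
  by move=> /(mono _ _ yX); rewrite e ltnn.
by move=> /(mono _ _ zX); rewrite e ltnn.
Qed.

Section Candidate.

Variables (s : state) (A B S : V * V) (y : V).
Hypotheses (ss : sound s) (sA : reads s rA A) (sB : reads s rB B)
  (sS : reads s rS S).
Let X := region G A B y.
Hypothesis sX : marks s X.

Lemma run_measure : [/\ cell (run measure s) = cell s,
  register (run measure s) rcount = #|X :&: cut G S| &
  register (run measure s) rrest = rest G (bound s) A B y S].
Proof.
rewrite /measure 2!run_Then; set s0 := run (Assign rrest _) _; set c := Cond _ _ _.
have s01 : register s0 1 = n by case: ss.
have [|j s' jn [ec e1 e2] fr|] := @For_ind rz c s0 (fun j s' => [/\ cell s' = cell s,
    register s' rcount = rank (X :&: cut G S) j
  & register s' rrest = \max_(z | (z \in X :\: cut G S) && (z < j))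
      minn (bound s A S z) (bound s S B z)]).
- by split=> //=; rewrite /rank big_pred0 // => z; rewrite andbF.
- rewrite s01 in jn; set z := Ordinal jn; set s1 := set_reg s' rz j.
  have ss1 : sound s1 by apply: sound_frame ss; rewrite //= fr.
  have z1 : register s1 rz = z by [].
  have [sA1 sB1 sS1] : [/\ reads s1 rA A, reads s1 rB B & reads s1 rS S].
    by rewrite /reads /= !fr.
  rewrite /rank !big_ltS -/z !in_setI !in_setD.
  have ez : eval (Read (mark rz)) s1 = (z \in X).
    by rewrite eval_Read (eval_mark ss1 z1) -sX -ec.
  rewrite /c (run_test _ _ ez).
  case: ifP => zX; last by rewrite andbF.
  rewrite andbT (run_test _ _ (eval_in_cut ss1 sS1 z1)).
  case: (boolP (z \in cut G S)) => zS; rewrite run_Assign; split=> //.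
    by rewrite /= e1 addnC.
  rewrite reg_set eqxx eval_Max eval_Min !eval_Read.
  by rewrite (eval_entry _ ss1 sA1 sS1 z1) (eval_entry _ ss1 sS1 sB1 z1) /= e2 ec maxnC.
by rewrite s01 /rank /rest !big_lt_n sum1_card.
Qed.


Lemma run_recolor m r (s' := run recolor s) :
    register s rcount = m -> register s rrest = r ->
  [/\ sound s', marks s' X,
      forall A' B' z, bound s' A' B' z =
        if [&& A' == A, B' == B & z \in X] then m + r else bound s A' B' z
    & forall A' B' z, color s' A' B' z =
        if [&& A' == A, B' == B & z \in X] then
          if z \in cut G S then r + rank (X :&: cut G S) z
          else if bound s A S z <= bound s S B z then color s A S z else color s S B z
        else color s A' B' z].
Proof.
move=> em er; rewrite /s' /recolor run_Then; set s0 := run (Assign _ _) s.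
set c := Cond _ _ _; have s01 : register s0 1 = n by case: ss.
pose new z := if z \in cut G S then r + rank (X :&: cut G S) z
  else if bound s A S z <= bound s S B z then color s A S z else color s S B z.
have [|j s2 jn [es eX ei eF eC] fr|] := @For_ind rz c s0 (fun j s' => [/\
    sound s', marks s' X, register s' rindex = rank (X :&: cut G S) j,
    forall A' B' z, bound s' A' B' z =
      if [&& A' == A, B' == B, z \in X & z < j] then m + r else bound s A' B' z
  & forall A' B' z, color s' A' B' z =
      if [&& A' == A, B' == B, z \in X & z < j] then new z else color s A' B' z]).
- split=> // [|A' B' z|A' B' z]; rewrite ?ltn0 ?andbF //.
  by rewrite /rank big_pred0 // => z; rewrite andbF.
- rewrite s01 in jn; set z := Ordinal jn; set s1 := set_reg s2 rz j.
  have ss1 : sound s1 by apply: sound_set_reg.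
  have z1 : register s1 rz = z by [].
  have [sA1 sB1 sS1] : [/\ reads s1 rA A, reads s1 rB B & reads s1 rS S].
    by rewrite /reads /= !fr.
  have ez : eval (Read (mark rz)) s1 = (z \in X).
    by rewrite eval_Read (eval_mark ss1 z1) -eX.
  have lej (w : V) : (w < j.+1) = (w == z) || (w < j).
    by rewrite ltnS leq_eqVlt -val_eqE.
  rewrite /c (run_test _ _ ez); case: ifP => zX; last first.
    split=> // [|A' B' w|A' B' w].
    + by rewrite /rank big_ltS -/z in_setI zX.
    + rewrite [LHS]eF; rewrite lej.
      by case: (eqVneq w z) => // ->; rewrite zX.
    + rewrite [LHS]eC; rewrite lej.
      by case: (eqVneq w z) => // ->; rewrite zX.
  rewrite run_Then (run_test _ _ (eval_in_cut ss1 sS1 z1)).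
  set s3 := (if _ then _ else _).
  have [[ss3 eX3] fr3 ei3 eF3 eC3] : [/\ sound s3 /\ marks s3 X,
      forall r, r != rindex -> register s3 r = register s1 r,
      register s3 rindex = rank (X :&: cut G S) j.+1,
      forall A' B' w, bound s3 A' B' w = bound s2 A' B' w
      & forall A' B' w, color s3 A' B' w =
        if [&& A' == A, B' == B & w == z] then new z else color s2 A' B' w].
    rewrite /s3; case: (boolP (z \in cut G S)) => zS.
      rewrite run_Then run_Write run_Assign (eval_entry 1 ss1 sA1 sB1 z1).
      split=> [|||A' B' w|A' B' w].
      - split; last by move=> w; rewrite -eX; apply: mark_set_tab.
        by apply: sound_set_reg => //; apply: sound_set_cell => //; apply: address_ge.
      - by move=> i ne; rewrite reg_set ifN.
      - by rewrite /= ei /rank big_ltS -/z in_setI zX zS addnC.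
      - by rewrite -[LHS]/(tab 0 (set_cell _ _ _) _ _ _) tab_set_tab.
      - rewrite -[LHS]/(tab 1 (set_cell _ _ _) _ _ _) tab_set_tab /new zS /=.
        by rewrite ei !fr //= er.
    have old t A' B' : tab t s1 A' B' z = tab t s2 A' B' z by [].
    have old0 A' B' : bound s1 A' B' z = bound s A' B' z.
      by rewrite old eF ltnn !andbF.
    have old1 A' B' : color s1 A' B' z = color s A' B' z.
      by rewrite old eC ltnn !andbF.
    have -> : run (Cond (Minus (Read (entry 0 rA rS rz)) (Read (entry 0 rS rB rz)))
        (Write (entry 1 rA rB rz) (Read (entry 1 rS rB rz)))
        (Write (entry 1 rA rB rz) (Read (entry 1 rA rS rz)))) s1
      = set_cell s1 (address 1 A.1 A.2 B.1 B.2 z) (new z).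
      rewrite run_Cond /new (negbTE zS) eval_Minus.
      rewrite !run_Write !eval_Read subn_eq0 !(eval_entry _ ss1 sA1 sS1 z1).
      rewrite !(eval_entry _ ss1 sS1 sB1 z1) !(eval_entry _ ss1 sA1 sB1 z1).
      rewrite -![cell s1 _]/(tab _ s1 _ _ z) !old0 !old1.
      by case: (leqP (bound s A S z) (bound s S B z)).
    split=> [|||A' B' w|A' B' w].
    - split; last by move=> w; rewrite -eX; apply: mark_set_tab.
      by apply: sound_set_cell => //; apply: address_ge.
    - by [].
    - by rewrite /= ei /rank big_ltS -/z in_setI zX (negbTE zS).
    - by rewrite tab_set_tab.
    - by rewrite tab_set_tab.
  have [sA3 sB3] : reads s3 rA A /\ reads s3 rB B by rewrite /reads !fr3.
  have z3 : register s3 rz = z by rewrite fr3.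
  rewrite run_Write (eval_entry 0 ss3 sA3 sB3 z3).
  have -> : eval (Plus (Var rcount) (Var rrest)) s3 = m + r.
    by rewrite /= !fr3 //= !fr //= em er.
  have pick (T : Type) (a b : T) A' B' w :
      (if [&& A' == A, B' == B & w == z] then a
       else if [&& A' == A, B' == B, w \in X & w < j] then a else b) =
      if [&& A' == A, B' == B, w \in X & w < j.+1] then a else b.
    case: (A' == A) (B' == B) => [] [] //=; rewrite lej.
    by case: eqVneq => //= ->; rewrite zX.
  split=> [|||A' B' w|A' B' w].
  + by apply: sound_set_cell => //; apply: address_ge.
  + by move=> w; rewrite -eX3; apply: mark_set_tab.
  + by [].
  + by rewrite tab_set_tab /= eF3 eF -pick.
  + rewrite tab_set_tab /= eC3 eC -pick.
    by case: eqVneq => //= _; case: eqVneq => //= _; case: eqVneq => //= ->.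
by rewrite s01 => ? ? ? eF eC; split=> // A' B' z; rewrite ?eF ?eC ltn_ord !andbT.
Qed.

End Candidate.

Lemma run_improve s A B S y (s' := run improve s) :
    sound s -> reads s rA A -> reads s rB B -> reads s rS S -> register s ry = y ->
    y \in area G A B -> marks s (region G A B y) -> valid G (bound s) (color s) ->
  [/\ sound s', marks s' (region G A B y), valid G (bound s') (color s'),
      forall A' B' z, bound s' A' B' z <= bound s A' B' z
    & bound s' A B y <= candidate G (bound s) A B y S].
Proof.
move=> ss sA sB sS sy yA sX sV; have [ec em er] := run_measure ss sA sB sS sX.
rewrite /s' /improve run_Then; set s1 := run measure s in ec em er *.
have fr r : r \notin assigned measure -> register s1 r = register s r.
  exact: run_frame.
have ss1 : sound s1 by apply: sound_frame ss; rewrite ?fr.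
have [sA1 sB1 sS1] : [/\ reads s1 rA A, reads s1 rB B & reads s1 rS S].
  by rewrite /reads !fr.
have sy1 : register s1 ry = y by rewrite fr.
have eb t : tab t s1 = tab t s by rewrite /tab ec.
have sX1 : marks s1 (region G A B y) by rewrite /marks ec.
rewrite run_Cond eval_Minus eval_Read (eval_entry 0 ss1 sA1 sB1 sy1).
rewrite -[cell s1 _]/(bound s1 A B y) eb /= em er subn_eq0 -ltnNge.
rewrite -/(candidate G (bound s) A B y S); case: ltnP => [lt|le]; last first.
  have e t : tab t (run skip s1) = tab t s by rewrite -eb.
  by rewrite !e; split=> //; apply: sound_set_reg.
have [ss2 sX2 eF eC] := run_recolor ss1 sA1 sB1 sS1 sX1 em er.
have eF' A' B' z : bound (run recolor s1) A' B' z =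
    if [&& A' == A, B' == B & z \in region G A B y]
    then candidate G (bound s) A B y S else bound s A' B' z.
  by rewrite eF eb.
have eC' A' B' z : color (run recolor s1) A' B' z =
    if [&& A' == A, B' == B & z \in region G A B y] then
      if z \in cut G S then rest G (bound s) A B y S + rank (region G A B y :&: cut G S) z
      else if bound s A S z <= bound s S B z then color s A S z else color s S B z
    else color s A' B' z.
  by rewrite eC !eb.
split=> // [|A' B' z|].
- exact: valid_update sV yA (@rank_inj _) (@rank_lt _) eF' eC'.
- rewrite eF'; case: and3P => // -[/eqP-> /eqP-> zX].
  by rewrite (valid_const sV yA zX) ltnW.
- by rewrite eF' !eqxx mem_component.
Qed.

Definition binds A B :=
  [:: (5, B.2 : nat); (4, B.1 : nat); (3, A.2 : nat); (2, A.1 : nat)].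

Lemma binds_reads A B P s : {subset binds A B <= P} -> holds P s ->
  reads s rA A /\ reads s rB B.
Proof.
move=> sub /allP h.
have get i a : (i, a) \in binds A B -> register s i = a by move=> /sub/h/eqP.
by split; split; apply: get; rewrite !inE eqxx ?orbT.
Qed.

Definition same_tables s s' := forall t A B z, t < 2 -> tab t s' A B z = tab t s A B z.

Section Marking.

Variables (s0 : state) (A B : V * V) (y : V).
Hypothesis yA : y \in area G A B.
Let X := region G A B y.
Let marked z s := cell s (address 2 0 0 0 0 z) = 1.

Let I (M : {set V}) s := [/\ sound s, same_tables s0 s,
  exists2 Y : {set V}, Y \subset X & marks s Y & {in M, forall z, marked z s}].

Let grow s s' := forall z, marked z s -> marked z s'.

Lemma achieves_spread (M : {set V}) (u z : V) : achieves (I M) grow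
  [:: (rz, z : nat), (ru, u : nat) & binds A B] spread
  (fun s => u \in M -> inrel G (area G A B) u z -> marked z s).
Proof.
move=> s [ss st [Y YX sY] sM] h.
have zz : register s rz = z by move: h => /andP[/eqP].
have uu : register s ru = u by move: h => /and3P[_ /eqP].
have [sA sB] : reads s rA A /\ reads s rB B.
  by apply: binds_reads h => x xb; rewrite 2!in_cons xb !orbT.
have et : eval (And (Read (mark ru)) (And (edge ru rz) (in_area rA rB rz))) s
    = (u \in Y) && (G u z && (z \in area G A B)).
  apply: eval_And; first by rewrite eval_Read (eval_mark ss uu) sY.
  by apply: eval_And; [apply: eval_edge | apply: eval_in_area].
rewrite /spread (run_test _ _ et); case: ifP => [/and3P[uY Guz zA]|no]; last first.
  split=> // [|uM /and3P[_ zA Guz]]; first by split=> //; exists Y.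
  by move: no; rewrite Guz zA !andbT -[u \in Y]lt0b -sY (sM u uM).
have zX : z \in X := component_closed (subsetP YX _ uY) zA Guz.
rewrite run_Write (eval_mark ss zz) /=.
have mz (w : V) : cell (set_cell s (address 2 0 0 0 0 z) 1) (address 2 0 0 0 0 w)
    = (w \in z |: Y).
  by rewrite mark_set_mark in_setU1 sY; case: eqVneq.
split=> [|w mw|_ _].
- split.
  + by apply: sound_set_cell => //; apply: address_ge.
  + by move=> t A' B' w t2; rewrite tab_set_mark ?st.
  + by exists (z |: Y) => //; rewrite subUset sub1set zX.
  + by move=> w wM; rewrite /marked mz in_setU1 -[w \in Y]lt0b -sY (sM w wM) orbT.
- by rewrite /marked mz in_setU1 -[w \in Y]lt0b -sY mw orbT.
- by rewrite /marked mz setU11.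
Qed.

Lemma achieves_round (M : {set V}) : achieves (I M) grow (binds A B)
  (For ru (For rz spread))
  (fun s => forall u z : V, u \in M -> inrel G (area G A B) u z -> marked z s).
Proof.
have In s : I M s -> register s 1 = n by case=> -[].
have Iset s i j : 1 < i -> I M s -> I M (set_reg s i j).
  by move=> i1 [ss ? ? ?]; split=> //; apply: sound_set_reg.
have lexx s : grow s s by [].
have leset s i j : grow s (set_reg s i j) by [].
have letr s1 s2 s3 : grow s1 s2 -> grow s2 s3 -> grow s1 s3.
  by move=> h1 h2 z /h1/h2.
have st (u z : V) : stable grow
    (fun s => u \in M -> inrel G (area G A B) u z -> marked z s).
  by move=> s s' h q uM uz; apply/h/q.
apply: achieves_For => // [u|u].
  by apply: stable_forall.
by apply: achieves_For => // z; apply: achieves_spread.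
Qed.

Lemma run_rounds s (s' := run (For rdist (For ru (For rz spread))) s) :
    I [set y] s -> holds (binds A B) s ->
  [/\ sound s', same_tables s0 s' & marks s' X].
Proof.
move=> Is h; have s1 : register s 1 = n by case: Is => -[].
have := @For_ind rdist (For ru (For rz spread)) s (fun j s' => I [set y] s' /\
  forall p, path (inrel G (area G A B)) y p -> size p <= j -> marked (last y p) s').
case=> [|j s2 jn [I2 M2] fr|].
- by split=> // -[|//] _ _; case: Is => _ _ _; apply; rewrite inE.
(* [M] freezes the marks present at the start of the round; those added during the round stay inside
   the region and do no harm. *)
- pose M : {set V} := [set z : V | cell s2 (address 2 0 0 0 0 z) == 1].
  have IM : I M (set_reg s2 rdist j).
    case: I2 => ss ? [Y YX sY] _; split=> //; first by exists Y.
    by move=> z; rewrite inE => /eqP.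
  have h2 : holds (binds A B) (set_reg s2 rdist j).
    by move: h; rewrite /holds /= !fr.
  have [[? ? ? _] gr rd] := achieves_round IM h2.
  have yM : marked y s2 by case: I2 => _ _ _; apply; rewrite inE.
  split; first by split=> // z; rewrite inE => /eqP ->; apply: gr.
  elim/last_ind=> [_ _|p x _]; first exact: gr.
  rewrite rcons_path size_rcons last_rcons => /andP[yp px] pj.
  by apply: rd px; rewrite inE; apply/eqP/M2.
rewrite s1 => -[ss st [Y YX sY] _] reach; split=> // z; rewrite sY; congr nat_of_bool.
apply/idP/idP => [/(subsetP YX)//|]; rewrite inE => /andP[_ /connectP[p0 yp0 ->]].
(* A simple path has at most [n] vertices, hence fewer than [n] steps, and all its vertices are
   reached within the [n] rounds. *)
case/shortenP: yp0 => p yp up _.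
rewrite -[_ \in Y]lt0b -sY reach //; have := max_card (mem (y :: p)).
by rewrite (card_uniqP up) card_ord => /ltnW.
Qed.

End Marking.

Lemma run_mark_region s A B y (s' := run mark_region s) :
    sound s -> reads s rA A -> reads s rB B -> register s ry = y -> y \in area G A B ->
  [/\ sound s', same_tables s s' & marks s' (region G A B y)].
Proof.
move=> ss sA sB sy yA; rewrite /s' /mark_region 2!run_Then.
set s1 := run (For rz _) s; have s11 : register s 1 = n by case: ss.
have [ss1 st1 cl1] : [/\ sound s1, same_tables s s1 & marks s1 set0].
  have := @For_ind rz (Write (mark rz) (Lit 0)) s (fun j s' => [/\ sound s',
    same_tables s s' & forall z : V, z < j -> cell s' (address 2 0 0 0 0 z) = 0]).
  case=> // [j s2 jn [ss2 st2 cl2] _|].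
    rewrite s11 in jn; have ss3 : sound (set_reg s2 rz j) by apply: sound_set_reg.
    rewrite run_Write (eval_mark (z := Ordinal jn) ss3) //.
    split; first by apply: sound_set_cell => //; apply: address_ge.
      by move=> t A' B' w t2; rewrite tab_set_mark -?st2.
    move=> z zj; rewrite mark_set_mark; case: eqVneq => // ne; apply: cl2.
    by move: zj ne; rewrite ltnS leq_eqVlt -val_eqE => /orP[->|].
  rewrite s11 => ? ? cl; split=> // z; rewrite inE; exact: cl.
have fr r : r \notin [:: rz] -> register s1 r = register s r.
  exact: (@run_frame (For rz (Write (mark rz) (Lit 0)))).
have sy1 : register s1 ry = y by rewrite fr.
rewrite run_Write (eval_mark ss1 sy1); apply: run_rounds => //.
  split.
  - by apply: sound_set_cell => //; apply: address_ge.
  - by move=> t A' B' w t2; rewrite tab_set_mark ?st1.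
  - exists [set y]; first by rewrite sub1set mem_component.
    by move=> z; rewrite mark_set_mark cl1 !inE; case: eqVneq.
  - by move=> z; rewrite inE => /eqP ->; rewrite mark_set_mark eqxx.
by case: sA sB => a1 a2 [b1 b2]; rewrite /holds /= !fr //= a1 a2 b1 b2 !eqxx.
Qed.

Lemma achieves_for_bounds c (J : state -> Prop) (le : state -> state -> Prop)
    (Q : V * V -> V * V -> V -> state -> Prop) i :
    (forall s, J s -> register s 1 = n) ->
    (forall s i j, 1 < i -> J s -> J (set_reg s i j)) ->
    (forall s, le s s) -> (forall s i j, le s (set_reg s i j)) ->
    (forall s1 s2 s3, le s1 s2 -> le s2 s3 -> le s1 s3) ->
    (forall A B z, stable le (Q A B z)) ->
    5 < i -> all (fun r => r \notin i :: assigned c) [:: 2; 3; 4; 5] ->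
    (forall A B z, achieves J le ((i, z : nat) :: binds A B) c (Q A B z)) ->
  achieves J le [::] (for_bounds (For i c)) (fun s => forall A B z, Q A B z s).
Proof.
move=> Jn Jset le0 leset letr st i5 fresh step s Js h.
have [r2 r3 r4 r5] : [/\ 2 \notin i :: assigned c, 3 \notin i :: assigned c,
    4 \notin i :: assigned c & 5 \notin i :: assigned c].
  by case/and5P: fresh.
have i1 : 1 < i by lia.
suff all5 : achieves J le [::] (for_bounds (For i c))
    (fun s => forall a1 a2 b1 b2 z : V, Q (a1, a2) (b1, b2) z s).
  by have [? ? q] := all5 s Js h; split=> // -[a1 a2] [b1 b2] z.
apply: achieves_For => // [a1|a1]; first by do 4!(apply: stable_forall => ?).
apply: achieves_For => // [|a2|a2]; first by rewrite /= !(inE, negb_or) in r2 *; rewrite r2.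
  by do 3!(apply: stable_forall => ?).
apply: achieves_For => // [|b1|b1].
  by rewrite /= !(inE, negb_or) in r2 r3 *; rewrite r2 r3.
  by do 2!(apply: stable_forall => ?).
apply: achieves_For => // [|b2|b2].
  by rewrite /= !(inE, negb_or) in r2 r3 r4 *; rewrite r2 r3 r4.
  by apply: stable_forall => ?.
apply: achieves_For => // [|z].
  by rewrite /= r2 r3 r4 r5.
exact: (step (a1, a2) (b1, b2) z).
Qed.

Section Pass.

Variable bound0 : table V.

Let I s := [/\ sound s, valid G (bound s) (color s)
  & forall A B z, bound s A B z <= bound0 A B z].
Let drop s s' := forall A B z, bound s' A B z <= bound s A B z.

Let drop_refl s : drop s s. Proof. by []. Qed.
Let drop_set s i j : drop s (set_reg s i j). Proof. by []. Qed.
Let drop_trans s1 s2 s3 : drop s1 s2 -> drop s2 s3 -> drop s1 s3.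
Proof. by move=> h1 h2 A B z; apply: leq_trans (h1 A B z). Qed.

Let stable_bound A B y m : stable drop (fun s => bound s A B y <= m).
Proof. by move=> s s' h; apply: leq_trans. Qed.

Lemma achieves_improve A B y (P := (ry, y : nat) :: binds A B) :
    y \in area G A B ->
  achieves (fun s => I s /\ marks s (region G A B y)) drop P
    (For rS.1 (For rS.2 improve))
    (fun s => forall c d : V, bound s A B y <= candidate G bound0 A B y (c, d)).
Proof.
move=> yA; set J := fun s => _.
have Jn s : J s -> register s 1 = n by case=> -[[]].
have Jset s i j : 1 < i -> J s -> J (set_reg s i j).
  by move=> i1 [[ss ? ?] ?]; split=> //; split=> //; apply: sound_set_reg.
apply: achieves_For => // [c|c].
  by apply: stable_forall => d; apply: stable_bound.
apply: achieves_For => // d s [[ss sV sb] sX] h.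
have sd : register s rS.2 = d by move: h => /andP[/eqP].
have sc : register s rS.1 = c by move: h => /and3P[_ /eqP].
have sy : register s ry = y by move: h => /and4P[_ _ /eqP].
have [sA sB] : reads s rA A /\ reads s rB B.
  by apply: binds_reads h => x xb; rewrite 3!in_cons xb !orbT.
have [ss' sX' sV' dr ca] :=
  run_improve ss sA sB (conj sc sd : reads s rS (c, d)) sy yA sX sV.
split=> //; first by split=> //; split=> // A' B' z; apply: leq_trans (sb A' B' z).
exact: leq_trans ca (candidate_le _ _ _ _ _ sb).
Qed.

Lemma achieves_improve_region A B y : achieves I drop ((ry, y : nat) :: binds A B)
  improve_region
  (fun s => y \in area G A B ->
    forall c d : V, bound s A B y <= candidate G bound0 A B y (c, d)).
Proof.
move=> s [ss sV sb] h; have sy : register s ry = y by move: h => /andP[/eqP].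
have [sA sB] : reads s rA A /\ reads s rB B.
  by apply: binds_reads h => x xb; rewrite in_cons xb orbT.
rewrite /improve_region (run_test _ _ (eval_in_area ss sA sB sy)).
case: (boolP (y \in area G A B)) => yA; last by split.
rewrite run_Then.
have [ss1 st1 sX1] := run_mark_region ss sA sB sy yA.
set s1 := run mark_region s in ss1 st1 sX1 *.
have eb : bound s1 = bound s.
  by apply: funext => A'; apply: funext => B'; apply: funext => z; apply: st1.
have eC : color s1 = color s.
  by apply: funext => A'; apply: funext => B'; apply: funext => z; apply: st1.
have fr r : r \notin assigned mark_region -> register s1 r = register s r.
  exact: run_frame.
have I1 : I s1 by rewrite /I eb eC.
have h1 : holds ((ry, y : nat) :: binds A B) s1 by move: h; rewrite /holds /= !fr.
have [[I2 _] dr ca] := achieves_improve yA (conj I1 sX1) h1.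
by split=> // A' B' z; rewrite -eb; apply: dr.
Qed.

(** The inequality on candidates, stated against the table before the pass, is the hypothesis of
    [optimal_step]; each pass thus handles regions with one more vertex. *)
Lemma run_pass s (s' := run pass s) : sound s ->
    valid G (bound s) (color s) -> (forall A B z, bound s A B z <= bound0 A B z) ->
  [/\ sound s', valid G (bound s') (color s') & forall A B y S, y \in area G A B ->
    bound s' A B y <= candidate G bound0 A B y S].
Proof.
move=> ss sV sb.
have In s1 : I s1 -> register s1 1 = n by case=> -[].
have Iset s1 i j : 1 < i -> I s1 -> I (set_reg s1 i j).
  by move=> i1 [? ? ?]; split=> //; apply: sound_set_reg.
have ach : achieves I drop [::] pass (fun s1 => forall A B y, y \in area G A B ->
    forall c d : V, bound s1 A B y <= candidate G bound0 A B y (c, d)).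
  apply: (achieves_for_bounds (Q := fun A B y s1 => y \in area G A B ->
    forall c d : V, bound s1 A B y <= candidate G bound0 A B y (c, d))) => //.
    by move=> A B y s1 s2 h q yA c d; apply: leq_trans (q yA c d).
  exact: achieves_improve_region.
have Is : I s by [].
have [[ss' sV' _] _ Q] := ach s Is isT.
by split=> // A B y [c d] yA; apply: Q.
Qed.

End Pass.

Lemma run_setup s (s' := run setup s) : sound s ->
  [/\ sound s', forall A B z, bound s' A B z = n & forall A B z, color s' A B z = z].
Proof.
move=> ss; pose done A B z s := bound s A B z = n /\ color s A B z = z.
pose le s1 s2 := forall A B z, done A B z s1 -> done A B z s2.
have ach : achieves sound le [::] setup (fun s1 => forall A B z, done A B z s1).
  apply: achieves_for_bounds => //.
  - by move=> s1 [].
  - by move=> s1 i j; apply: sound_set_reg.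
  - by move=> s1 A B z.
  - by move=> s1 i j A B z.
  - by move=> s1 s2 s3 h1 h2 A B z /h1/h2.
  - by move=> A B z s1 s2 h /h.
  move=> A B z s1 ss1 h; have zz : register s1 rz = z by move: h => /andP[/eqP].
  have [sA sB] : reads s1 rA A /\ reads s1 rB B.
    by apply: binds_reads h => x xb; rewrite in_cons xb orbT.
  rewrite run_Then !run_Write (eval_entry 0 ss1 sA sB zz).
  set s2 := set_cell s1 _ _; have ss2 : sound s2.
    by apply: sound_set_cell => //; apply: address_ge.
  have e2 : eval (Var rz) s2 = z := zz.
  rewrite (eval_entry 1 ss2 (sA : reads s2 rA A) (sB : reads s2 rB B) e2) e2.
  have e1 : eval (Var 1) s1 = n by case: ss1.
  rewrite /s2 e1; split.
  - apply: sound_set_cell; first exact: address_ge.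
    by apply: sound_set_cell => //; apply: address_ge.
  - move=> A' B' z' [d1 d2]; split; rewrite !tab_set_tab /=.
      by rewrite d1; case: ifP.
    by rewrite d2; case: and3P => // -[_ _ /eqP ->].
  - by split; rewrite !tab_set_tab /= !eqxx.
by have [? _ d] := ach s ss isT; split=> // A B z; case: (d A B z).
Qed.

Lemma valid_identity (F C : table V) :
  (forall A B z, F A B z = n) -> (forall A B z, C A B z = z) -> valid G F C.
Proof.
move=> eF eC A B; split=> [X _ /set0Pn[v vX] _|z _|y z _ _ _].
- by exists v => // w _; rewrite !eC => /val_inj.
- by rewrite eC eF.
- by rewrite !eF.
Qed.

Lemma run_passes rk s (s' := run (For rround pass) s) : umbrella G rk -> sound s ->
    valid G (bound s) (color s) ->
  [/\ sound s', valid G (bound s') (color s') & optimal_upto G rk n (bound s')].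
Proof.
move=> rk_umb ss sV; have s1 : register s 1 = n by case: ss.
have := @For_ind rround pass s (fun j s' => [/\ sound s',
  valid G (bound s') (color s') & optimal_upto G rk j (bound s')]).
case=> [|j s2 jn [ss2 sV2 op2] _| ss' sV']; last by rewrite s1.
(* Optimality up to size 0 is vacuous: a region contains its base vertex. *)
- split=> // T phi A B p q y eA eB yb; rewrite leqn0 cards_eq0 => /eqP r0.
  have := mem_component G (subsetP (between_area eA eB) y yb).
  by rewrite -/(region _ _ _ _) r0 inE.
- have [||? ? opt] := @run_pass (bound s2) (set_reg s2 rround j) _ sV2.
  + exact: sound_set_reg.
  + by [].
  by split=> //; apply: optimal_step op2 opt.
Qed.

Lemma output_report s (o : V) (D := (o, o)) : o = 0 :> nat -> sound s ->
  output (run report s) =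
    \max_z bound s D D z :: [seq (color s D D z).+1 | z <- enum V].
Proof.
move=> o0 ss; rewrite /report run_Then; set s1 := run _ s.
have [ss1 sA1 sB1] : [/\ sound s1, reads s1 rA D & reads s1 rB D].
  by split; [do !apply: sound_set_reg | |]; rewrite // /reads /= o0.
have eb t : tab t s1 = tab t s by [].
rewrite run_Then; set s2 := run _ s1; rewrite run_Then; set s3 := run _ s2.
have s21 : register s2 1 = n by case: ss.
have [e3 m3] : cell s3 = cell s /\ register s3 rrest = \max_z bound s D D z.
  have := @For_ind rz (Assign rrest (Max (Var rrest) (Read (entry 0 rA rB rz)))) s2
    (fun j s' => cell s' = cell s /\
       register s' rrest = \max_(z : V | predT z && (z < j)) bound s D D z).
  case=> [|j s' jn [ec er] fr|].
  - by split=> //; rewrite big_pred0.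
  - rewrite s21 in jn; set z := Ordinal jn; set s4 := set_reg s' rz j.
    have ss4 : sound s4 by apply: sound_frame ss; rewrite //= fr.
    have [sA4 sB4] : reads s4 rA D /\ reads s4 rB D by rewrite /reads /= !fr // /= o0.
    have z4 : register s4 rz = z by [].
    rewrite run_Assign eval_Max eval_Read (eval_entry 0 ss4 sA4 sB4 z4).
    rewrite big_ltS -/z; split=> //.
    by rewrite reg_set eqxx /= er ec maxnC.
  by rewrite s21 big_lt_n.
have fr3 r : r \notin [:: rz; rrest] -> register s3 r = register s2 r.
  exact: (@run_frame (For rz (Assign rrest (Max (Var rrest) (Read (entry 0 rA rB rz)))))).
have ss3 : sound s3 by apply: sound_frame ss; rewrite ?fr3.
rewrite run_Then; set c := Write (Plus _ _) _; set s4 := run (For rz c) s3.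
have fr4 r : r != rz -> register s4 r = register s3 r.
  by move=> h; apply: run_frame; rewrite inE.
have s31 : register s3 1 = n by case: ss3.
have c4 (z : V) : cell s4 (1 + z) = (color s D D z).+1.
  have := @For_ind rz c s3 (fun j s' =>
    (forall a, L <= a -> cell s' a = cell s a) /\
    forall z : V, z < j -> cell s' (1 + z) = (color s D D z).+1).
  case=> [|j s' jn [ec er] fr|_].
  - by split=> // a _; rewrite e3.
  - rewrite s31 in jn; set w := Ordinal jn; rewrite /c run_Write.
    have -> : eval (Plus (Lit 1) (Var rz)) (set_reg s' rz j) = 1 + j by [].
    (* The colors are written over the input, below the start of the tables, so the entries still to
       be read are intact. *)
    have jL : 1 + j < L.
      by apply: leq_ltn_trans L_large; rewrite (leq_trans jn) ?leq_pmulr //; lia.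
    split=> [a La|v].
      by rewrite cell_set ifN ?ec //; apply: contraTneq La => ->; rewrite -ltnNge.
    rewrite ltnS leq_eqVlt cell_set eqn_add2l; case: eqVneq => [e _|_ /er //].
    have -> : v = w by apply: val_inj.
    have [s50 s51] : register (set_reg s' rz j) 0 = L /\ register (set_reg s' rz j) 1 = n.
      by rewrite /= !fr //; case: ss3.
    have [sA5 sB5] : reads (set_reg s' rz j) rA D /\ reads (set_reg s' rz j) rB D.
      by rewrite /reads /= !fr // !fr3 //= o0.
    have w5 : register (set_reg s' rz j) rz = w by [].
    transitivity (eval (Read (entry 1 rA rB rz)) (set_reg s' rz j)).+1.
      exact: addn1.
    rewrite eval_Read (eval_entry_regs 1 s50 s51 sA5 sB5 w5) /= ec; last exact: address_ge.
    exact: erefl.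
  by rewrite s31; apply.
rewrite run_Then /output.
have -> : register (run (Assign 0 (Plus (Var 1) (Lit 1))) (run (Write (Lit 0) (Var rrest)) s4)) 0 = n.+1.
  by rewrite /= fr4 // s31 addn1.
apply: (@eq_from_nth _ 0) => [|i]; first by rewrite size_mkseq /= size_map size_enum_ord.
rewrite size_mkseq ltnS => i_le; rewrite nth_mkseq ?ltnS //.
case: i i_le => [_|i i_lt] /=; first by rewrite fr4.
by rewrite (nth_map o) ?size_enum_ord // -{1}[i]/(val (Ordinal i_lt)) -add1n c4 (nth_ord_enum o (Ordinal i_lt)).
Qed.

End Verification.

(** * Input, output and assembly *)

Lemma nth_allpairs (S T : Type) (x0 : S) (y0 : T) (s : seq S) (t : seq T) (f : S -> T -> nat) i j :
  i < size s -> j < size t ->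
  nth 0 [seq f x y | x <- s, y <- t] (i * size t + j) = f (nth x0 s i) (nth y0 t j).
Proof.
elim: s i => // x s IHs [|i] is_ jt /=; rewrite nth_cat size_map.
  by rewrite mul0n jt (nth_map y0).
by rewrite mulSn -addnA ltnNge leq_addr /= addKn IHs.
Qed.

Lemma run_For0 i c s : register s 1 = 0 -> run (For i c) s = s.
Proof. by move=> /= ->. Qed.

Lemma output_report0 s : register s 1 = 0 -> output (run report s) = [:: 0].
Proof. by move=> s1; rewrite /report !run_Then !run_For0 //= /output /= s1. Qed.

(** Register 0 already holds the input length, the address where the tables begin. The number of
    vertices, in cell 0, is fetched into register 1; 17 is the first register that [main] leaves
    free. *)
Definition code :=
  Seq (Const 1 0) (Seq (Fetch 1 1) (stmt_code main 17)).

Section Assembly.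

Variables (n k : nat) (G : sgraph 'I_n) (psi : 'I_n -> 'I_k).
Local Notation V := 'I_n.
Let input := encode_input G psi.
Let start := set_reg (initial input) 1 n.

Lemma size_input : size input = (n * n).+1 + k.+1 - k + n.
Proof.
by rewrite size_cat /= size_allpairs size_map size_enum_ord; lia.
Qed.

Lemma leq_bit_size : n <= bit_size input.
Proof.
apply: (@leq_trans (size input)); first by rewrite size_input; lia.
by rewrite -sum1_size; apply: leq_sum.
Qed.

Lemma sound_start : sound (size input) G start.
Proof.
split=> // u v; rewrite -[LHS]/(nth 0 input _) nth_cat /= size_allpairs size_enum_ord.
rewrite ltnS; have uv : u * n + v < n * n.
  by have := ltn_ord u; have := ltn_ord v; nia.
rewrite uv; have := @nth_allpairs V V u v (enum V) (enum V) (fun u v => G u v) u v.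
by rewrite size_enum_ord !nth_ord_enum; apply.
Qed.

Lemma exec_code : exists t,
  runs code input t (output (run main start)) /\ t <= stmt_cost main n + 2.
Proof.
pose s1 := set_reg (initial input) 1 0; pose s2 := set_reg s1 1 (cell s1 (register s1 1)).
have ag0 : agree 17 s2 start by split=> // i _ /=; case: eqP.
have used17 : all (gtn 17) (used main) by [].
have keep1 : 1 \notin assigned main by [].
have [T [s [ex le ag _]]] := stmt_codeP used17 keep1 isT (leqnn 17) ag0.
exists (1 + (1 + T)); split; last by move: le; rewrite -[register s2 1]/n; lia.
exists s; last by rewrite /output ag.1 //; apply: eq_mkseq => i; rewrite ag.2.
exact: exec_seq (exec_const _ _ _) (exec_seq (exec_fetch _ _ _) ex).
Qed.

Lemma output_main (rk : V -> nat) m :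
    umbrella G rk -> depth_le G m [set: V] ->
  exists p (phi : V -> 'I_p), [/\ output (run main start) = encode_coloring phi,
    centered_coloring G phi & p <= m].
Proof.
move=> rk_umb dm.
have L_large : n * n < size input by rewrite size_input; lia.
have [ss1 b1 c1] := run_setup L_large sound_start.
rewrite /main 2!run_Then; set s1 := run setup _ in ss1 b1 c1 *.
have [ss2 sV opt] := run_passes L_large rk_umb ss1 (valid_identity G b1 c1).
set s2 := run _ s1 in ss2 sV opt *.
(* Without vertices there is no pair to bound a region; all loops are empty and the output is the
   coloring of size 0. *)
have [n0|n0] := posnP n.
  have phi : V -> 'I_0 by case=> i; rewrite {1}n0.
  exists 0, phi; split=> //.
  - rewrite output_report0; last by case: ss2 => _ ->.
    by rewrite /encode_coloring (size0nil (s := enum V)) ?size_enum_ord.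
  - move=> H [/set0Pn[v _] _]; by case: (phi v).
pose o : V := Ordinal n0; pose D := (o, o).
have aT : area G D D = setT.
  by rewrite /area /barrier eqxx setU0 setC0.
have [cD ltD _] := sV D D.
pose M := \max_z tab (size input) 0 s2 D D z.
have ltM z : tab (size input) 1 s2 D D z < M.
  apply: leq_trans (leq_bigmax z); apply: ltD; by rewrite aT.
exists M, (fun z => Ordinal (ltM z)); split.
- by rewrite (@output_report n _ G L_large s2 o).
- apply: centered_onT; rewrite -aT => X XD X0 Xc.
  have [v vX vu] := cD X XD X0 Xc; by exists v => // w wX [] /(vu w wX).
rewrite /M; apply/bigmax_leqP => y _; have [phi lt cphi] := dm.
pose phi' z := Ordinal (lt z (in_setT z)).
(* No vertex crosses position 0 or a position beyond all ranks, which matches the empty barrier of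
   [D]; the whole graph lies between the two. *)
have top : is_crossing G rk D 0.
  by rewrite /is_crossing /barrier eqxx; apply/setP => z; rewrite !inE.
have bot : is_crossing G rk D (\max_z rk z).+1.
  rewrite /is_crossing /barrier eqxx; apply/setP => z; rewrite !inE.
  by rewrite ltnNge leq_bigmax.
have yb : y \in between G rk 0 (\max_z rk z).+1 by rewrite inE ltnS leq_bigmax.
apply: leq_trans (opt _ phi' D D _ _ y top bot yb _ _) _.
- by rewrite -[X in _ <= X]card_ord max_card.
- move=> X XD X0 Xc; have [v vX vu] := cphi X (subsetT X) X0 Xc.
  by exists v => // w wX [] /(vu w wX).
by rewrite -[X in _ <= X]card_ord max_card.
Qed.

End Assembly.

Theorem theorem5 (R : realType) :
  exists (A : prog) (p : {poly nat}),
    forall (n k : nat) (G : sgraph 'I_n) (psi : 'I_n -> 'I_k),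
      interval_graph R G -> linear_coloring G psi ->
      exists (m : nat) (phi : 'I_n -> 'I_m) (t : nat),
        [/\ runs A (encode_input G psi) t (encode_coloring phi),
            t <= (p.[bit_size (encode_input G psi)])%R,
            centered_coloring G phi &
            m <= k ^ 2].
Proof.
have [p pE] := polynomialD (stmt_cost_polynomial main) (polynomial_const 2).
exists code, p => n k G psi /interval_umbrella[rk rk_umb] psi_lin.
have dk : depth_le G (k ^ 2) [set: 'I_n].
  apply: (colors_depth psi_lin rk_umb).
  by rewrite -[X in _ <= X]card_ord max_card.
have [m [phi [out cen mk]]] := output_main psi rk_umb dk.
have [t [ex tb]] := exec_code G psi.
exists m, phi, t; split=> //; first by rewrite -out.
by apply: leq_trans tb _; rewrite pE leq_horner // leq_bit_size.
Qed.
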